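(* Let $A\in\mathbb{P}(2n)$ and let $f:\mathbb{R}^n_{++}\to\mathbb{R}$ be symmetric. Then $f\circ d:\mathbb{P}(2n)\to\mathbb{R}$ is strictly Fréchet differentiable at $A$ if and only if $f$ is strictly Fréchet differentiable at $d(A)$.
   Context: $n$ is a positive integer and $\mathbb{R}^n_{++}$ is the set of vectors in $\mathbb{R}^n$ with strictly positive entries. $\mathbb{S}(2n)$ is the space of real symmetric $2n\times 2n$ matrices with inner product $\langle A,B\rangle=\operatorname{Tr}(A^\top B)$ and the induced (Frobenius) norm; $\mathbb{P}(2n)\subset\mathbb{S}(2n)$ is the open subset of positive definite matrices. For $x\in\mathbb{R}^n$, $D_x:=\operatorname{Diag}(x)\oplus\operatorname{Diag}(x)$. A real $2n\times 2n$ matrix $M$ is symplectic if $M^\top JM=J$ with $J=\begin{pmatrix}0&I_n\\-I_n&0\end{pmatrix}$. By Williamson's theorem, for each $A\in\mathbb{P}(2n)$ there is a unique vector $d(A)=(d_1(A),\dots,d_n(A))\in\mathbb{R}^n_{++}$ with $d_1(A)\le\cdots\le d_n(A)$ such that $M^\top AM=D_{d(A)}$ for some symplectic $M$. A function $f:\mathbb{R}^n_{++}\to\mathbb{R}$ is symmetric if $f(Px)=f(x)$ for all $x\in\mathbb{R}^n_{++}$ and all $n\times n$ permutation matrices $P$. A function $F$ on an open subset of a finite-dimensional Euclidean space is strictly Fréchet differentiable at $x$ if it is Fréchet differentiable at $x$ with derivative $DF(x)$ and $\lim_{y\to x,\ \|u\|\to0}\frac{\|F(y+u)-F(y)-DF(x)(u)\|}{\|u\|}=0$.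 *)

(* Defs.v *)
From HB Require Import structures.
From mathcomp Require Import all_boot all_order all_algebra.
From mathcomp Require Import all_classical all_reals all_analysis.

Set Implicit Arguments.
Unset Strict Implicit.
Unset Printing Implicit Defensive.

Import Order.TTheory GRing.Theory Num.Theory.
Import numFieldNormedType.Exports.

Local Open Scope classical_set_scope.
Local Open Scope ring_scope.

Section Frobenius.
Context {R : realType} {m n : nat}.
Implicit Types A B : 'M[R]_(m, n).

Definition frob_dot A B : R := \tr (A^T *m B).

Definition frob_norm A : R := Num.sqrt (frob_dot A A).

Lemma frob_dotE A B : frob_dot A B = \sum_j \sum_i A i j * B i j.
Proof.
by apply: eq_bigr => j _; rewrite mxE; apply: eq_bigr => i _; rewrite mxE.
Qed.

Lemma frob_dotC A B : frob_dot A B = frob_dot B A.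
Proof. by rewrite /frob_dot -mxtrace_tr trmx_mul trmxK. Qed.

Lemma frob_dotDr A B C : frob_dot A (B + C) = frob_dot A B + frob_dot A C.
Proof. by rewrite /frob_dot mulmxDr mxtraceD. Qed.

Lemma frob_dotZr a A B : frob_dot A (a *: B) = a * frob_dot A B.
Proof. by rewrite /frob_dot -scalemxAr mxtraceZ. Qed.

Lemma frob_dotDl A B C : frob_dot (A + B) C = frob_dot A C + frob_dot B C.
Proof. by rewrite frob_dotC frob_dotDr !(frob_dotC C). Qed.

Lemma frob_dotZl a A B : frob_dot (a *: A) B = a * frob_dot A B.
Proof. by rewrite frob_dotC frob_dotZr frob_dotC. Qed.

Lemma frob_dot_ge0 A : 0 <= frob_dot A A.
Proof.
by rewrite frob_dotE; do 2![apply: sumr_ge0 => ? _]; rewrite -expr2 sqr_ge0.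
Qed.

Lemma frob_dot_eq0 A : frob_dot A A = 0 -> A = 0.
Proof.
rewrite frob_dotE => /eqP; rewrite psumr_eq0; last first.
  by move=> j _; apply: sumr_ge0 => i _; rewrite -expr2 sqr_ge0.
move=> /allP A0; apply/matrixP => i j; rewrite mxE.
have := A0 j; rewrite mem_index_enum => /(_ isT); rewrite psumr_eq0; last first.
  by move=> ? _; rewrite -expr2 sqr_ge0.
move=> /allP /(_ i); rewrite mem_index_enum => /(_ isT).
by rewrite -expr2 sqrf_eq0 => /eqP.
Qed.

Lemma frob_CauchySchwarz A B :
  frob_dot A B ^+ 2 <= frob_dot A A * frob_dot B B.
Proof.
have [A0|A0] := eqVneq (frob_dot A A) 0.
  rewrite (frob_dot_eq0 A0) -(scale0r (0 : 'M[R]_(m, n))) !frob_dotZl.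
  by rewrite !mul0r expr0n.
have Agt0 : 0 < frob_dot A A by rewrite lt_def A0 frob_dot_ge0.
have := frob_dot_ge0 (frob_dot A A *: B - frob_dot A B *: A).
rewrite -scaleNr frob_dotDl !frob_dotDr !frob_dotZl !frob_dotZr (frob_dotC B A).
set a := frob_dot A A in Agt0 *; set b := frob_dot B B; set c := frob_dot A B.
have -> : a * (a * b) + a * (- c * c) + (- c * (a * c) + - c * (- c * a))
  = a * (a * b - c ^+ 2).
  rewrite !mulNr !mulrN opprK expr2 (mulrCA c a) addrA.
  rewrite (mulrC c a) (mulrCA c a) subrK.
  by rewrite mulrBr.
by rewrite pmulr_rge0// subr_ge0.
Qed.

Lemma frob_normD A B : frob_norm (A + B) <= frob_norm A + frob_norm B.
Proof.
have s0 : 0 <= frob_norm A + frob_norm B by rewrite addr_ge0 ?sqrtr_ge0.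
rewrite -[leRHS]ger0_norm// -sqrtr_sqr ler_wsqrtr//.
rewrite sqrrD !sqr_sqrtr ?frob_dot_ge0// frob_dotDl !frob_dotDr (frob_dotC B A).
rewrite addrA lerD2r -addrA lerD2l -mulr2n lerMn2r /=.
rewrite -sqrtrM ?frob_dot_ge0//.
apply: le_trans (ler_norm _) _.
by rewrite -sqrtr_sqr ler_wsqrtr// frob_CauchySchwarz.
Qed.

Lemma frob_normZ a A : frob_norm (a *: A) = `|a| * frob_norm A.
Proof.
by rewrite /frob_norm frob_dotZl frob_dotZr mulrA -expr2 sqrtrM ?sqr_ge0//
   sqrtr_sqr.
Qed.

Lemma frob_norm_eq0 A : frob_norm A = 0 -> A = 0.
Proof.
move=> /eqP; rewrite sqrtr_eq0 => A0; apply: frob_dot_eq0.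
by apply/eqP; rewrite eq_le A0 frob_dot_ge0.
Qed.

End Frobenius.

(* The library norms matrices by the maximum of the absolute values of their
   entries, hence new carriers: [euclid] is R^n with the Euclidean norm, [sym_mx]
   is the space of symmetric matrices with the Frobenius norm. *)
Definition euclid (R : realType) (n : nat) : Type := 'cV[R]_n.

HB.instance Definition _ (R : realType) n :=
  GRing.Lmodule.copy (euclid R n) 'cV[R]_n.
HB.instance Definition _ (R : realType) n :=
  @Lmodule_isNormed.Build R (euclid R n) (@frob_norm R n 1)
    frob_normD frob_normZ frob_norm_eq0.

Section SymmetricSubmodule.
Context {R : realType} {n : nat}.

Definition is_sym_mx : {pred 'M[R]_n} := fun A => A^T == A.

Lemma is_sym_mxP (A : 'M[R]_n) : reflect (A^T = A) (A \in is_sym_mx).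
Proof. exact: eqP. Qed.

Lemma is_sym_mx_closed : submod_closed is_sym_mx.
Proof.
split=> [|a A B]; first by apply/is_sym_mxP; rewrite trmx0.
move=> /is_sym_mxP sA /is_sym_mxP sB; apply/is_sym_mxP.
by rewrite linearP /= sA sB.
Qed.

HB.instance Definition _ :=
  GRing.isSubmodClosed.Build R 'M[R]_n is_sym_mx is_sym_mx_closed.

End SymmetricSubmodule.

Record sym_mx (R : realType) (n : nat) : Type := SymMx {
  sym_val :> 'M[R]_n;
  sym_valP : sym_val \in is_sym_mx }.

Section SymMx.
Context (R : realType) (n : nat).

HB.instance Definition _ := [isSub for @sym_val R n].
HB.instance Definition _ := [Choice of sym_mx R n by <:].
HB.instance Definition _ := [SubChoice_isSubLmodule of sym_mx R n by <:].

Let normD (A B : sym_mx R n) :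
  frob_norm (A + B : sym_mx R n) <= frob_norm A + frob_norm B.
Proof. exact: frob_normD. Qed.

Let normZ a (A : sym_mx R n) : frob_norm (a *: A : sym_mx R n) = `|a| * frob_norm A.
Proof. exact: frob_normZ. Qed.

Let norm_eq0 (A : sym_mx R n) : frob_norm A = 0 -> A = 0.
Proof. by move=> /frob_norm_eq0 A0; apply: val_inj. Qed.

HB.instance Definition _ :=
  @Lmodule_isNormed.Build R (sym_mx R n) (fun A => frob_norm A)
    normD normZ norm_eq0.

End SymMx.

(* The pairs (y, u) tend to (x, 0) independently, with u != 0. A function given
   on an open set is represented by any total extension of it: at a point of
   that open set only the values near the point matter. *)
Definition strictly_differentiable (R : realType) (V W : normedModType R)
    (F : V -> W) (x : V) : Prop :=
  differentiable F x /\
  (fun yu : V * V =>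
     `|F (yu.1 + yu.2) - F yu.1 - 'd F x yu.2| / `|yu.2|)
    @ filter_prod (nbhs x) (0 : V)^' --> (0 : R).

Section Williamson.
Context {R : realType} {n : nat}.

Definition posdef {k} (A : sym_mx R k) : Prop :=
  forall x : 'cV[R]_k, x != 0 -> 0 < (x^T *m A *m x) 0 0.

Definition Jmx : 'M[R]_(n + n) := block_mx 0 1%:M (- 1%:M) 0.

Definition symplectic (M : 'M[R]_(n + n)) : Prop := M^T *m Jmx *m M = Jmx.

Definition Dmx (x : 'cV[R]_n) : 'M[R]_(n + n) :=
  block_mx (diag_mx x^T) 0 0 (diag_mx x^T).

Definition pos_vec (x : 'cV[R]_n) : Prop := forall i, 0 < x i 0.

Definition williamson_vec (A : 'M[R]_(n + n)) (x : 'cV[R]_n) : Prop :=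
  [/\ pos_vec x,
      forall i j : 'I_n, (i <= j)%N -> x i 0 <= x j 0 &
      exists2 M, symplectic M & M^T *m A *m M = Dmx x].

(* By Williamson's theorem exactly one vector qualifies when [A] is positive
   definite; the value is irrelevant (0) when there is none. *)
Definition symplectic_eigenvalues (A : sym_mx R (n + n)) : euclid R n :=
  xget 0 (williamson_vec A).

(* Only the values of [f] on positive vectors are constrained. *)
Definition symmetric_fun (f : euclid R n -> R) : Prop :=
  forall (P : 'M[R]_n) (x : euclid R n),
    is_perm_mx P -> pos_vec x -> f (P *m x) = f x.

End Williamson.

(* Main.v *)
(** Let [a = d(A)] and [N^T A N = D_a] with [N] symplectic.

    If [f o d] is strictly differentiable at [A], compose it with the linear map
    [y |-> N^-T D_y N^-1]: for [y > 0] the symplectic eigenvalues of the image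
    are the entries of [y] in increasing order, so the composite is [f] near [a]
    by symmetry.

    For the converse, Williamson's theorem is obtained together with the
    principle [2 sum_i w_i d_i(B) = min_M tr (D_w M^T B M)] ([M] symplectic, [w]
    positive and decreasing): a minimiser exists by compactness and diagonalises
    [B], as the first variation along symplectic transvections shows.  If [M_B]
    diagonalises [B], it competes in the minimum for [C], and conversely; hence
    [2 sum_i w_i (d_i(C) - d_i(B))] lies between [<M_C D_w M_C^T, C - B>] and
    [<M_B D_w M_B^T, C - B>].  This makes [d] locally Lipschitz.  When [w_i = w_j]
    whenever [a_i = a_j], moreover [M_B D_w M_B^T -> N D_w N^T] as [B -> A], since
    [N^-1 M_B] asymptotically commutes with [J] and [D_w]; so [sum_i w_i d_i] is
    strictly differentiable at [A].  By symmetry of [f] its gradient at [a] is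
    constant on the ties of [a], hence a difference of two such weights. *)

Require Import Defs.
From HB Require Import structures.
From mathcomp Require Import all_boot all_order all_fingroup all_algebra.
From mathcomp Require Import all_classical all_reals all_analysis.
From mathcomp Require Import ring lra.

Set Implicit Arguments.
Unset Strict Implicit.
Unset Printing Implicit Defensive.

Import Order.TTheory GRing.Theory Num.Theory.
Import numFieldNormedType.Exports.

Local Open Scope classical_set_scope.
Local Open Scope ring_scope.

(** * Strict differentiability *)

(* Arithmetic on norms in [sym_mx] goes through these inequalities between abstract
   reals: [lra] compares such norms up to conversion, which is prohibitively slow. *)
Section RealInequalities.
Context {R : realType}.

Lemma lt_min_and (x y z : R) : x < Num.min y z -> x < y /\ x < z.
Proof. by rewrite lt_min => /andP. Qed.

Lemma two_sided_bound (s f x y : R) : 0 <= x -> 0 <= y ->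
  2 * s - f <= x -> 2 * - s - - f <= y -> `|2 * s - f| <= x + y.
Proof. by move=> x0 y0 Hx Hy; rewrite ler_norml; apply/andP; split; lra. Qed.

Lemma lt_of_half (x r : R) : 0 < r -> x < r / 2 -> x < r.
Proof. lra. Qed.

Lemma lt_of_halves (x y z r : R) : z <= x + y -> x < r / 2 -> y < r / 2 -> z < r.
Proof. lra. Qed.

Lemma mulr_lt_of_div (l x r : R) : 0 <= l -> 0 <= x -> x < r / (l + 1) -> l * x < r.
Proof.
move=> l0 x0; rewrite ltr_pdivlMr; last by lra.
by rewrite mulrC mulrDl mul1r; lra.
Qed.

Lemma half_share (e l v x : R) : 0 < e -> 0 <= l -> 0 <= v -> x <= l * v ->
  e / (2 * (l + 1)) * x <= e / 2 * v.
Proof.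
move=> e0 l0 v0 xlv.
have l1 : 0 < l + 1 by lra.
have -> : e / 2 * v = e / (2 * (l + 1)) * ((l + 1) * v) by field; rewrite gt_eqF.
rewrite ler_pM2l ?divr_gt0 ?mulr_gt0//; lra.
Qed.

Lemma third_share (e k b c v : R) : 0 <= k -> 0 < e -> c <= b + v ->
  b < e / (3 * (k + 1)) -> v < e / (3 * (k + 1)) -> k * (b + c) <= e.
Proof.
move=> k0 e0 cbv bq vq.
have k1 : 0 < k + 1 by lra.
have q0 : 0 < e / (3 * (k + 1)) by rewrite divr_gt0 ?mulr_gt0.
have -> : e = (k + 1) * (3 * (e / (3 * (k + 1)))) by field; rewrite gt_eqF.
move: (e / _) q0 bq vq => q q0 bq vq.
have q3 : b + c <= 3 * q by lra.
apply: (@le_trans _ _ (k * (3 * q))); first exact: ler_wpM2l.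
by rewrite ler_wpM2r//; lra.
Qed.

Lemma approx_combine (h D e v s : R) : `|D - s| <= e / 2 * v ->
  `|2 * s - h| <= e * v -> `|D - 2^-1 * h| <= e * v.
Proof.
rewrite !ler_norml => /andP[H1 H2] /andP[H3 H4]; apply/andP; split; lra.
Qed.

End RealInequalities.

Section StrictDifferentiability.
Context {R : realType} {V W : normedModType R}.
Implicit Types (F : V -> W) (L : {linear V -> W}).

(** An epsilon-delta form with one radius for [y] and [u], where [u = 0] is harmless for linear [L].
    The candidate [L] is arbitrary, so no differential need be known in advance. *)
Definition strict_approx F (L : V -> W) (x : V) : Prop :=
  forall e : R, 0 < e -> exists2 del : R, 0 < del &
    forall y u, `|y - x| < del -> `|u| < del ->
      `|F (y + u) - F y - L u| <= e * `|u|.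

Lemma strictly_differentiable_approx F x :
  strictly_differentiable F x -> strict_approx F ('d F x) x.
Proof.
move=> [_ /cvgrPdist_le cvgF] e e0.
have [[P Q] [/= /nbhs_ballP[p /= p0 xP] /nbhs_ballP[q /= q0 xQ]] PQ] := cvgF e e0.
exists (Num.min p q); first by rewrite lt_min p0.
move=> y u; rewrite !lt_min => /andP[yp _] /andP[_ uq].
have [->|u0] := eqVneq u 0.
  by rewrite addr0 subrr linear0 subrr !normr0 mulr0.
have /= := PQ (y, u); rewrite sub0r normrN ger0_norm ?divr_ge0//.
rewrite ler_pdivrMr ?normr_gt0//; apply; split.
  by apply: xP; rewrite -ball_normE /= distrC.
by apply: xQ => //; rewrite -ball_normE /= sub0r normrN.
Qed.

(** The case [y = x] is Fréchet differentiability; continuity of [L] lets uniqueness of the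
    differential identify it with [L]. *)
Lemma approx_strictly_differentiable F L x :
  continuous L -> strict_approx F L x -> strictly_differentiable F x.
Proof.
move=> cL FL.
have Fx : F \o shift x = (cst (F x) + L) +o_ (0 : V) id.
  apply/eqaddoP => e e0.
  have [del del0 Fdel] := FL e e0.
  apply/nbhs_ballP; exists del => //= u; rewrite -ball_normE /= sub0r normrN => ud.
  have := Fdel x u; rewrite subrr normr0 => /(_ del0 ud) /=.
  by rewrite !fctE /= (addrC u) /cst opprD addrA.
have dF : 'd F x = L :> (V -> W) by exact: diff_unique.
split; first by apply/diff_locallyP; rewrite dF.
rewrite dF; apply/cvgrPdist_le => e e0.
have [del del0 Fdel] := FL e e0.
exists (ball x del, [set u : V | `|u| < del /\ u != 0]) => /=.
  split; first exact: nbhsx_ballx.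
  apply/nbhs_ballP; exists del => //= u; rewrite -ball_normE /= sub0r normrN.
  by move=> ud u0; split=> //; apply/eqP.
move=> [y u] [/= yx [ud u0]]; rewrite sub0r normrN ger0_norm ?divr_ge0//.
rewrite ler_pdivrMr ?normr_gt0//; apply: Fdel => //.
by move: yx; rewrite -ball_normE /= distrC.
Qed.

End StrictDifferentiability.

Lemma bounded_linear_continuous (R : realType) (V W : normedModType R)
    (L : {linear V -> W}) (k : R) :
  (forall x, `|L x| <= k * `|x|) -> continuous L.
Proof.
move=> Lk; apply/linear_bounded_continuous/linear_boundedP.
exists k; split=> [|r /ltW kr x]; first exact: num_real.
by apply: le_trans (Lk x) _; rewrite ler_wpM2r.
Qed.

(** * Frobenius norm and symplectic matrices *)

Section FrobeniusBounds.
Context {R : realType}.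

Lemma frob_norm_ge0 m n (A : 'M[R]_(m, n)) : 0 <= frob_norm A.
Proof. exact: sqrtr_ge0. Qed.

Lemma sqr_frob_norm m n (A : 'M[R]_(m, n)) : frob_norm A ^+ 2 = frob_dot A A.
Proof. by rewrite sqr_sqrtr ?frob_dot_ge0. Qed.

Lemma frob_normN m n (A : 'M[R]_(m, n)) : frob_norm (- A) = frob_norm A.
Proof. by rewrite -scaleN1r frob_normZ normrN1 mul1r. Qed.

Lemma frob_dot_le m n (A B : 'M[R]_(m, n)) :
  `|frob_dot A B| <= frob_norm A * frob_norm B.
Proof.
rewrite -(ger0_norm (mulr_ge0 (frob_norm_ge0 A) (frob_norm_ge0 B))).
by rewrite -ler_sqr ?nnegrE ?normr_ge0// !real_normK ?num_real//
  exprMn !sqr_frob_norm frob_CauchySchwarz.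
Qed.

Lemma frob_norm_tr m n (A : 'M[R]_(m, n)) : frob_norm A^T = frob_norm A.
Proof. by rewrite /frob_norm /frob_dot trmxK mxtrace_mulC. Qed.

Lemma entry_le_frob_norm m n (A : 'M[R]_(m, n)) i j : `|A i j| <= frob_norm A.
Proof.
rewrite -(ger0_norm (frob_norm_ge0 A)) -ler_sqr ?nnegrE ?normr_ge0//.
rewrite !real_normK ?num_real// sqr_frob_norm frob_dotE.
rewrite (bigD1 j)//= (bigD1 i)//= -expr2 -addrA lerDl addr_ge0// sumr_ge0// => k _.
  by rewrite -expr2 sqr_ge0.
by apply: sumr_ge0 => l _; rewrite -expr2 sqr_ge0.
Qed.

Lemma frob_dotBl m n (X Y Z : 'M[R]_(m, n)) :
  frob_dot (X - Y) Z = frob_dot X Z - frob_dot Y Z.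
Proof. by rewrite -scaleN1r frob_dotDl frob_dotZl mulN1r. Qed.

(** After Cauchy-Schwarz on every entry, row against column, the double sum factors into the two
    squared norms. *)
Lemma frob_normM m n p (A : 'M[R]_(m, n)) (B : 'M[R]_(n, p)) :
  frob_norm (A *m B) <= frob_norm A * frob_norm B.
Proof.
rewrite -ler_sqr ?nnegrE ?mulr_ge0 ?frob_norm_ge0// exprMn !sqr_frob_norm.
have E i j : (A *m B) i j = frob_dot (row i A)^T (col j B).
  rewrite /frob_dot trmxK /mxtrace big_ord1 !mxE.
  by apply: eq_bigr => k _; rewrite !mxE.
rewrite frob_dotE.
apply: (@le_trans _ _ (\sum_j \sum_i frob_dot (row i A)^T (row i A)^T *
    frob_dot (col j B) (col j B))).
  by apply: ler_sum => j _; apply: ler_sum => i _; rewrite -expr2 E frob_CauchySchwarz.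
rewrite exchange_big /= -big_distrlr /= le_eqVlt; apply/orP; left; apply/eqP.
congr (_ * _); last first.
  rewrite frob_dotE; apply: eq_bigr => j _; rewrite frob_dotE big_ord1.
  by apply: eq_bigr => i _; rewrite !mxE.
rewrite [RHS]frob_dotE [RHS]exchange_big; apply: eq_bigr => i _.
rewrite frob_dotE big_ord1.
by apply: eq_bigr => k _; rewrite !mxE.
Qed.

End FrobeniusBounds.

Section SymplecticAlgebra.
Context {R : realType} {n : nat}.
Implicit Types (M N K A B : 'M[R]_(n + n)) (x y : 'cV[R]_n).

Local Notation J := (@Jmx R n).

Definition dbl x : 'rV[R]_(n + n) := row_mx x^T x^T.

Lemma DmxE x : Dmx x = diag_mx (dbl x).
Proof. by rewrite diag_mx_row. Qed.

Lemma dbl_map (h : R -> R) x : dbl (map_mx h x) = map_mx h (dbl x).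
Proof. by rewrite /dbl map_row_mx map_trmx. Qed.

Lemma Dmx_tr x : (Dmx x)^T = Dmx x.
Proof. by rewrite DmxE tr_diag_mx. Qed.

Lemma DmxD x y : Dmx (x + y) = Dmx x + Dmx y.
Proof. by rewrite !DmxE -linearD/= /dbl add_row_mx linearD. Qed.

Lemma DmxZ k x : Dmx (k *: x) = k *: Dmx x.
Proof. by rewrite !DmxE -linearZ/= /dbl scale_row_mx linearZ. Qed.

Lemma mxtrace_Dmx x : \tr (Dmx x) = 2 * \sum_i x i 0.
Proof.
rewrite /Dmx mxtrace_block mxtrace_diag -mulr2n mulr_natl.
by congr (_ *+ 2); apply: eq_bigr => i _; rewrite mxE.
Qed.

Lemma mxtrace_DmxM x y : \tr (Dmx x *m Dmx y) = 2 * \sum_i x i 0 * y i 0.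
Proof.
rewrite /Dmx mulmx_block !mulmx0 !mul0mx !addr0 !add0r mulmx_diag mxtrace_block.
rewrite mxtrace_diag -mulr2n mulr_natl.
by congr (_ *+ 2); apply: eq_bigr => i _; rewrite !mxE.
Qed.

Lemma Jmx_sqr : J *m J = - 1%:M.
Proof.
rewrite /Jmx mulmx_block !mulmx0 !mul0mx !mul1mx mulmx1 !addr0 !add0r.
by rewrite [in RHS]scalar_mx_block opp_block_mx oppr0.
Qed.

Lemma Jmx_tr : J^T = - J.
Proof.
by rewrite /Jmx tr_block_mx opp_block_mx !trmx0 linearN /= trmx1 !oppr0 opprK.
Qed.

Lemma Jmx_Dmx x : J *m Dmx x = Dmx x *m J.
Proof.
rewrite /Jmx /Dmx !mulmx_block !mulmx0 !mul0mx !addr0 !add0r.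
by rewrite !mul1mx !mulmx1 !mulNmx !mulmxN mul1mx mulmx1.
Qed.

Lemma symplectic1 : symplectic (1%:M : 'M[R]_(n + n)).
Proof. by rewrite /symplectic trmx1 mul1mx mulmx1. Qed.

Lemma symplecticM M N : symplectic M -> symplectic N -> symplectic (M *m N).
Proof.
rewrite /symplectic => HM HN.
by rewrite trmx_mul -!mulmxA (mulmxA J) (mulmxA M^T) (mulmxA M^T) HM mulmxA.
Qed.

Lemma symplectic_mulVmx M : symplectic M -> (- (J *m M^T *m J)) *m M = 1%:M.
Proof.
move=> HM; have := HM; rewrite /symplectic => E.
by rewrite mulNmx -!mulmxA (mulmxA M^T) E Jmx_sqr opprK.
Qed.

Lemma symplectic_unitmx M : symplectic M -> M \in unitmx.
Proof. by move=> /symplectic_mulVmx /mulmx1_unit []. Qed.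

(** The left inverse [- J M^T J] is also a right inverse, hence [M^T] is symplectic too. *)
Lemma symplectic_tr M : symplectic M -> M *m J *m M^T = J.
Proof.
move=> /symplectic_mulVmx /mulmx1C.
rewrite mulmxN !mulmxA => /(congr1 (fun X => X *m J)).
rewrite mulNmx -(mulmxA _ J J) Jmx_sqr mulmxN mulmx1 opprK mul1mx.
by [].
Qed.

Lemma symplecticV M : symplectic M -> symplectic (invmx M).
Proof.
move=> HM; have uM := symplectic_unitmx HM.
rewrite /symplectic -[in LHS]HM !mulmxA -trmx_mul mulmxV// trmx1 mul1mx.
by rewrite -mulmxA mulmxV// mulmx1.
Qed.

(** Turns a congruence of [A] and [D] into a similarity of [J A] and [J D], through
    [K J K^T = J]. *)
Lemma symplectic_intertwine A K (D : 'M[R]_(n + n)) :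
  symplectic K -> K^T *m A *m K = D -> J *m A *m K = K *m J *m D.
Proof.
by move=> HK <-; rewrite !mulmxA symplectic_tr.
Qed.

(** [J] commutes with [D_z], so [(J D_z)^2 = - D_z^2]: applying the intertwining twice removes
    [J]. *)
Lemma Dmx_intertwine_sqr (K : 'M[R]_(n + n)) x y :
    J *m Dmx y *m K = K *m J *m Dmx x ->
  Dmx y *m Dmx y *m K = K *m (Dmx x *m Dmx x).
Proof.
move=> E; have H2 z : (J *m Dmx z) *m (J *m Dmx z) = - (Dmx z *m Dmx z).
  rewrite [in X in X *m _]Jmx_Dmx mulmxA -(mulmxA (Dmx z)) Jmx_sqr.
  by rewrite mulmxN mulmx1 mulNmx.
apply: oppr_inj; rewrite -mulNmx -H2 -mulmxN -H2.
by rewrite -(mulmxA (J *m Dmx y)) E !mulmxA E.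
Qed.

(* Intertwining of diagonal matrices only depends on the pairs of equal diagonal
   entries, hence survives applying a function entrywise. *)
Lemma diag_intertwine_map (h : R -> R) m (d e : 'rV[R]_m) (K : 'M[R]_m) :
    diag_mx d *m K = K *m diag_mx e ->
  diag_mx (map_mx h d) *m K = K *m diag_mx (map_mx h e).
Proof.
move=> E; apply/matrixP => i j; move/matrixP: E => /(_ i j).
rewrite !mul_diag_mx !mul_mx_diag !mxE mulrC => /eqP.
rewrite -subr_eq0 -mulrBr mulf_eq0 subr_eq0 => /orP[/eqP ->|/eqP ->].
  by rewrite mulr0 mul0r.
by rewrite mulrC.
Qed.

Lemma symplectic_Dmx_perm K x y : pos_vec x -> pos_vec y -> symplectic K ->
  K^T *m Dmx y *m K = Dmx x -> exists s : 'S_n, forall i, x i 0 = y (s i) 0.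
Proof.
move=> x0 y0 HK /(symplectic_intertwine HK) /Dmx_intertwine_sqr.
have sqrD z : Dmx z *m Dmx z = diag_mx (map_mx (fun t => t ^+ 2) (dbl z)).
  rewrite DmxE mulmx_diag; congr diag_mx; apply/rowP => i.
  by rewrite !mxE expr2.
rewrite !sqrD => E.
have two0 : (2 : R) != 0 by rewrite pnatr_eq0.
have cnt v : 0 < v -> \sum_i ((y i 0 == v)%:R : R) = \sum_i (x i 0 == v)%:R.
  (* The indicator of [v^2] turns both squares into 0-1 diagonal matrices, still similar; their
     traces count the occurrences of [v], each twice. *)
  move=> v0; have := diag_intertwine_map (fun t => (t == v ^+ 2)%:R) E.
  move=> /(congr1 (fun X => invmx K *m X)); rewrite mulKmx ?symplectic_unitmx//.
  move=> /(congr1 mxtrace); rewrite mxtrace_mulC mulmxK ?symplectic_unitmx//.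
  rewrite -!dbl_map -!DmxE !mxtrace_Dmx => /(mulfI two0) C.
  have : \sum_i ((y i 0 ^+ 2 == v ^+ 2)%:R : R) = \sum_i (x i 0 ^+ 2 == v ^+ 2)%:R.
    by move: C; under eq_bigr do rewrite !mxE; under [RHS]eq_bigr do rewrite !mxE.
  under eq_bigr do rewrite eqrXn2 ?ltW//.
  by under [RHS]eq_bigr do rewrite eqrXn2 ?ltW//.
have S (z : 'cV[R]_n) v :
    (\sum_(i < n) (z i 0%R == v) = count_mem v [tuple z i 0%R | i < n])%N.
  rewrite count_map -sum1_count [RHS]big_mkcond /= big_enum /=.
  by apply: eq_bigr => i _; case: eqP.
have /tuple_permP[s Hs] : perm_eq [tuple x i 0 | i < n] [tuple y i 0 | i < n].
  apply/allP => v; rewrite mem_cat => v_in /=.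
  have v0 : 0 < v by case/orP: v_in => /mapP[i _ ->].
  have := cnt v v0; rewrite -!natr_sum => /eqP; rewrite eqr_nat eq_sym.
  by rewrite !S.
exists s => i.
have := congr1 (fun t => tnth t i) (val_inj Hs).
by rewrite !tnth_mktuple.
Qed.

End SymplecticAlgebra.

(** * The symplectic trace minimum *)

Section SymplecticTraceMinimum.
Context {R : realType}.

(** [posdef] restated for bare matrices, since the congruent matrices [M^T A M] are not packaged in
    [sym_mx]. *)
Definition pd_mx m (A : 'M[R]_m) : Prop :=
  forall x : 'cV[R]_m, x != 0 -> 0 < (x^T *m A *m x) 0 0.

Lemma pd_unitmx m (A : 'M[R]_m) : A^T = A -> pd_mx A -> A \in unitmx.
Proof.
move=> sA pA; rewrite unitmxE unitfE; apply/negP => /det0P[v v0 vA].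
have : v^T != 0 by apply: contra v0 => /eqP/(congr1 trmx); rewrite trmxK trmx0 => ->.
by move/pA; rewrite trmxK vA mul0mx mxE ltxx.
Qed.

Lemma quad_form_frob m (A : 'M[R]_m) (x : 'cV_m) :
  (x^T *m A *m x) 0 0 = frob_dot x (A *m x).
Proof. by rewrite /frob_dot mulmxA /mxtrace big_ord1. Qed.

(* Evaluate the form at [x - t A^-1 x] with [t] the inverse of a bound on the
   norm of [A^-1]. *)
Lemma pd_coercive m (A : 'M[R]_m) : A^T = A -> pd_mx A ->
  exists2 c, 0 < c & forall x : 'cV_m, c * frob_dot x x <= (x^T *m A *m x) 0 0.
Proof.
move=> sA pA; have uA := pd_unitmx sA pA.
set k := frob_norm (invmx A) + 1.
have k0 : 0 < k by rewrite ltr_wpDl ?frob_norm_ge0.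
exists k^-1; rewrite ?invr_gt0// => x.
have Ak : frob_dot x (invmx A *m x) <= k * frob_dot x x.
  apply: le_trans (ler_norm _) _; apply: le_trans (frob_dot_le _ _) _.
  rewrite -sqr_frob_norm expr2 mulrCA ler_wpM2l ?frob_norm_ge0//.
  apply: le_trans (frob_normM _ _) _; rewrite ler_wpM2r ?frob_norm_ge0//.
  by rewrite lerDl.
set t := k^-1; pose z := x - t *: (invmx A *m x).
have : 0 <= (z^T *m A *m z) 0 0.
  by have [->|/pA/ltW//] := eqVneq z 0; rewrite mulmx0 mxE.
rewrite !quad_form_frob /z mulmxBr -scalemxAr mulKVmx// -!scaleNr.
rewrite frob_dotDl !frob_dotDr !frob_dotZl !frob_dotZr.
have -> : frob_dot (invmx A *m x) (A *m x) = frob_dot x x.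
  by rewrite /frob_dot trmx_mul trmx_inv sA mulmxA mulmxKV.
rewrite (frob_dotC _ x).
have tk : t * k = 1 by rewrite mulVf ?gt_eqF.
have t0 : 0 < t by rewrite invr_gt0.
have : t * t * frob_dot x (invmx A *m x) <= t * t * (k * frob_dot x x).
  by rewrite ler_wpM2l// mulr_ge0 ?ltW.
rewrite [X in _ <= X -> _](_ : _ = (t * k) * (t * frob_dot x x)); last by ring.
rewrite tk; lra.
Qed.

Context {n : nat}.
Implicit Types (A M N K : 'M[R]_(n + n)) (w x : 'cV[R]_n).
Local Notation J := (@Jmx R n).

Definition symp_form A w N : R := \tr (Dmx w *m (N^T *m A *m N)).

Lemma symp_form_frob A w N : A^T = A ->
  symp_form A w N = frob_dot (N *m Dmx w *m N^T) A.
Proof.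
move=> sA; rewrite /symp_form /frob_dot !trmx_mul trmxK Dmx_tr.
by rewrite -[in RHS]mulmxA [RHS]mxtrace_mulC !mulmxA.
Qed.

Lemma symp_formM A w M N : symp_form A w (M *m N) = symp_form (M^T *m A *m M) w N.
Proof. by rewrite /symp_form trmx_mul !mulmxA. Qed.

Lemma symp_form_sum A w N :
  symp_form A w N =
  \sum_j dbl w 0 j * ((col j N)^T *m A *m col j N) 0 0.
Proof.
rewrite /symp_form DmxE /mxtrace; apply: eq_bigr => j _.
rewrite mul_diag_mx !mxE; congr (_ * _); apply: eq_bigr => k _.
by rewrite !mxE; congr (_ * _); apply: eq_bigr => l _; rewrite !mxE.
Qed.

Lemma dbl_gt0 w : pos_vec w -> forall j, 0 < dbl w 0 j.
Proof.
by move=> w0 j; rewrite mxE; case: splitP => k _; rewrite mxE.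
Qed.

Lemma row_lower_bound m (d : 'rV[R]_m) : (forall j, 0 < d 0 j) ->
  exists2 c, 0 < c & forall j, c <= d 0 j.
Proof.
move=> d0.
suff [c c0 cd] : exists2 c, 0 < c & {in enum 'I_m, forall j, c <= d 0 j}.
  by exists c => // j; rewrite cd ?mem_enum.
elim: (enum _) => [|j s [c c0 cs]]; first by exists 1.
exists (Num.min c (d 0 j)); first by rewrite lt_min c0 d0.
move=> i; rewrite inE => /orP[/eqP ->|/cs]; first by rewrite ge_min lexx orbT.
by rewrite ge_min => ->.
Qed.

(** The form is a positively weighted sum of values of [A] at the columns of [N]. This bounds the
    sublevel sets, the symplectic group not being compact in general. *)
Lemma symp_form_coercive A w : A^T = A -> pd_mx A -> pos_vec w ->
  exists2 c, 0 < c & forall N, c * frob_norm N ^+ 2 <= symp_form A w N.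
Proof.
move=> sA pA /dbl_gt0/row_lower_bound[b b0 bw].
have [c c0 cA] := pd_coercive sA pA.
exists (b * c); rewrite ?mulr_gt0// => N.
rewrite symp_form_sum sqr_frob_norm frob_dotE mulr_sumr; apply: ler_sum => j _.
have -> : \sum_i N i j * N i j = frob_dot (col j N) (col j N).
  by rewrite frob_dotE big_ord1; apply: eq_bigr => i _; rewrite !mxE.
rewrite -mulrA; apply: ler_pM; [exact: ltW| |exact: bw|exact: cA].
by rewrite mulr_ge0 ?frob_dot_ge0// ltW.
Qed.

Lemma continuous_sum (T : topologicalType) I (r : seq I) (f : I -> T -> R) :
  (forall i, continuous (f i)) -> continuous (fun v => \sum_(i <- r) f i v).
Proof.
move=> cf; elim: r => [|i r IH] v.
  by under eq_fun do rewrite big_nil; exact: cvg_cst.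
under eq_fun do rewrite big_cons.
by apply: cvgD; [exact: cf|exact: IH].
Qed.

Lemma continuous_mulmx (T : topologicalType) m p q
    (F : T -> 'M[R]_(m, p)) (G : T -> 'M[R]_(p, q)) :
    (forall i j, continuous (fun v => F v i j)) ->
    (forall i j, continuous (fun v => G v i j)) ->
  forall i j, continuous (fun v => (F v *m G v) i j).
Proof.
move=> cF cG i j; under eq_fun do rewrite mxE.
by apply: continuous_sum => k v; apply: cvgM; [exact: cF|exact: cG].
Qed.

(** The minimum is sought on the sublevel set of the identity, closed by continuity and bounded by
    coercivity. Matrices are flattened to row vectors, where closed bounded sets are compact. *)
Lemma symp_form_min_exists A w : A^T = A -> pd_mx A -> pos_vec w ->
  exists2 M, symplectic M &
    forall N, symplectic N -> symp_form A w M <= symp_form A w N.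
Proof.
move=> sA pA w0; have [c c0 cA] := symp_form_coercive sA pA w0.
pose phi (v : 'rV[R]_((n + n) * (n + n))) := symp_form A w (vec_mx v).
pose S : set 'rV[R]_((n + n) * (n + n)) :=
  [set v | symplectic (vec_mx v) /\ phi v <= symp_form A w 1%:M].
have cV i j : continuous (fun v : 'rV[R]_((n + n) * (n + n)) => vec_mx v i j).
  under eq_fun do rewrite mxE.
  exact: coord_continuous.
have cVT i j : continuous (fun v : 'rV[R]_((n + n) * (n + n)) => (vec_mx v)^T i j).
  by under eq_fun do rewrite mxE; exact: cV.
have cC (B : 'M[R]_(n + n)) i j : continuous
    (fun _ : 'rV[R]_((n + n) * (n + n)) => B i j).
  exact: cst_continuous.
have cphi : continuous phi.
  apply: continuous_sum => i; apply: continuous_mulmx => // k l.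
  by apply: continuous_mulmx => // *; apply: continuous_mulmx.
have clS : closed S.
  have -> : S = (\bigcap_i \bigcap_j
      [set v | ((vec_mx v)^T *m J *m vec_mx v) i j = J i j]) `&`
      [set v | phi v <= symp_form A w 1%:M].
    apply/seteqP; split=> v [vS vphi]; split=> //.
      by move=> i _ j _ /=; rewrite (vS : _ = J).
    apply/matrixP => i j; exact: vS.
  apply: closedI; last first.
    exact: ((continuous_closedP phi).1 cphi _ (@closed_le _ (symp_form A w 1%:M))).
  apply: closed_bigI => i _; apply: closed_bigI => j _.
  have cJ : continuous (fun v : 'rV[R]_((n + n) * (n + n)) =>
      ((vec_mx v)^T *m J *m vec_mx v) i j).
    by apply: continuous_mulmx => // *; apply: continuous_mulmx.
  exact: ((continuous_closedP _).1 cJ _ (@closed_eq _ (J i j))).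
have bS : bounded_set S.
  exists (Num.sqrt (c^-1 * symp_form A w 1%:M)); split; first exact: num_real.
  move=> b /ltW ltb v [_ vphi]; apply: le_trans ltb.
  rewrite /= [`|v|]mx_normrE; apply/bigmax_leP; split; first exact: sqrtr_ge0.
  move=> [i k] _ /=; rewrite (ord1 i); case/mxvec_indexP: k => i' j'.
  have -> : v 0 (mxvec_index i' j') = vec_mx v i' j' by rewrite mxE.
  apply: le_trans (entry_le_frob_norm _ _ _) _.
  apply: ler_wsqrtr; rewrite -sqr_frob_norm -ler_pdivrMl ?invr_gt0// invrK.
  exact: le_trans (cA _) vphi.
have S0 : S !=set0.
  by exists (mxvec 1%:M); rewrite /S /phi /= mxvecK; split=> //; exact: symplectic1.
have [v /set_mem[vS vphi] vmin] := compact_EVT_min S0 (bounded_closed_compact bS clS)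
  (continuous_subspaceT cphi).
exists (vec_mx v) => // N HN.
have [N1|/ltW N1] := leP (symp_form A w N) (symp_form A w 1%:M).
  have := vmin (mxvec N); rewrite /phi mxvecK; apply; apply/mem_set.
  by rewrite /S /phi /= mxvecK.
exact: le_trans N1.
Qed.

End SymplecticTraceMinimum.

(** * Williamson's theorem *)

Section Williamson.
Context {R : realType} {n : nat}.
Implicit Types (A B M N K : 'M[R]_(n + n)) (w x y : 'cV[R]_n).
Local Notation J := (@Jmx R n).

Lemma tr_congr A M : A^T = A -> (M^T *m A *m M)^T = M^T *m A *m M.
Proof. by move=> sA; rewrite !trmx_mul trmxK sA mulmxA. Qed.

Lemma pd_congr A M : M \in unitmx -> pd_mx A -> pd_mx (M^T *m A *m M).
Proof.
move=> uM pA x x0; have := pA (M *m x).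
rewrite trmx_mul !mulmxA; apply; apply: contra x0 => /eqP Mx0.
by rewrite -(mulKmx uM x) Mx0 mulmx0.
Qed.

Lemma congr_invmx A B M : M \in unitmx -> M^T *m A *m M = B ->
  (invmx M)^T *m B *m invmx M = A.
Proof.
move=> uM <-; rewrite !mulmxA -trmx_mul mulmxV// trmx1 mul1mx.
by rewrite -mulmxA mulmxV// mulmx1.
Qed.

Lemma skew_form0 (v : 'cV[R]_(n + n)) : v^T *m J *m v = 0.
Proof.
apply/matrixP => i j; rewrite !ord1 [RHS]mxE.
suff : (v^T *m J *m v) 0 0 = - (v^T *m J *m v) 0 0 by lra.
rewrite -[in LHS](trmxK (v^T *m J *m v)) mxE.
by rewrite !trmx_mul trmxK Jmx_tr mulNmx mulmxN mulmxA [LHS]mxE.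
Qed.

(** With [X = v v^T J], the term [X^T J + J X] vanishes because [J] is skew, and [X^T J X] contains
    [v^T J v = 0]. These curves in the group are affine in [t], so a minimum can be tested without
    calculus on the group. *)
Lemma transvection_symplectic (v : 'cV[R]_(n + n)) (t : R) :
  symplectic (1%:M + t *: (v *m v^T *m J)).
Proof.
set X := v *m v^T *m J.
have XT : X^T = - (J *m v *m v^T) by rewrite !trmx_mul trmxK Jmx_tr mulNmx mulmxA.
have XJ : X^T *m J = - (J *m X) by rewrite XT mulNmx !mulmxA.
have XJX : X^T *m J *m X = 0.
  rewrite XJ mulNmx /X !mulmxA -(mulmxA (J *m v)) -(mulmxA (J *m v)).
  by rewrite skew_form0 mulmx0 !mul0mx oppr0.
rewrite /symplectic.
have -> : (1%:M + t *: X)^T = 1%:M + t *: X^T by rewrite raddfD /= linearZ /= trmx1.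
rewrite mulmxDl mul1mx mulmxDr mulmx1 -scalemxAr mulmxDl -!scalemxAl.
by rewrite XJX scaler0 addr0 XJ scalerN subrK.
Qed.

Lemma linear_coef_eq0 (a b : R) : (forall t, 0 <= t * a + t ^+ 2 * b) -> a = 0.
Proof.
move=> H; apply/eqP/negP => /negP a0.
pose k := `|b| + 1.
have k0 : 0 < k by rewrite ltr_wpDl.
have bk : b <= k by rewrite (le_trans (ler_norm b))// lerDl.
(* The minimiser of [t a + t^2 k]; since [b <= k], the value there is negative unless [a = 0]. *)
have := H (- a / (2 * k)).
have -> : - a / (2 * k) * a + (- a / (2 * k)) ^+ 2 * b =
    (a / (2 * k)) ^+ 2 * (b - 2 * k) by field; rewrite gt_eqF.
apply/negP; rewrite -ltNge pmulr_rlt0; first by lra.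
by rewrite exprn_even_gt0//= mulf_neq0// invr_neq0// mulf_neq0 ?gt_eqF.
Qed.

(** Polarisation, at two basis vectors and their sum. *)
Lemma quad_form0_skew m (Z : 'M[R]_m) :
  (forall v : 'cV_m, (v^T *m Z *m v) 0 0 = 0) -> Z^T = - Z.
Proof.
move=> Z0; apply/matrixP => i j; rewrite !mxE.
have E k l : ((delta_mx k 0 : 'cV[R]_m)^T *m Z *m (delta_mx l 0 : 'cV_m)) 0 0 = Z k l.
  by rewrite trmx_delta -rowE -colE !mxE.
have addmxE (P Q : 'M[R]_1) : (P + Q) 0 0 = P 0 0 + Q 0 0 by rewrite mxE.
have := Z0 (delta_mx i 0 + delta_mx j 0).
have -> : (delta_mx i 0 + delta_mx j 0 : 'cV[R]_m)^T =
    (delta_mx i 0 : 'cV_m)^T + (delta_mx j 0 : 'cV_m)^T by rewrite raddfD.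
rewrite !mulmxDl !mulmxDr !addmxE !E.
by have := Z0 (delta_mx i 0); have := Z0 (delta_mx j 0); rewrite !E; lra.
Qed.

(* First variation of the trace along the transvections [1 + t v v^T J]. *)
Lemma symp_form_critical B w : B^T = B ->
    (forall K, symplectic K -> symp_form B w 1%:M <= symp_form B w K) ->
  B *m (J *m Dmx w) = J *m Dmx w *m B.
Proof.
move=> sB Bmin.
(* The term of degree 1 in [t] is [2 v^T Z v], so minimality makes [Z] skew-symmetric; with [ZT]
   this is the commutation. *)
pose Z := J *m Dmx w *m B.
have ZT : Z^T = - (B *m (J *m Dmx w)).
  by rewrite /Z !trmx_mul sB Dmx_tr Jmx_tr !mulmxN Jmx_Dmx.
have trB Y : \tr (Dmx w *m (Y^T *m B)) = \tr (Dmx w *m (B *m Y)).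
  by rewrite -[LHS]mxtrace_tr !trmx_mul trmxK sB Dmx_tr [LHS]mxtrace_mulC.
have qZ (v : 'cV[R]_(n + n)) : (v^T *m Z *m v) 0 0 = 0.
  set X := v *m v^T *m J.
  suff : 2 * (v^T *m Z *m v) 0 0 = 0 by lra.
  apply: (@linear_coef_eq0 _ (\tr (Dmx w *m (X^T *m B *m X)))) => t.
  have KE : (1%:M + t *: X)^T *m B *m (1%:M + t *: X) =
      B + t *: (X^T *m B + B *m X) + t ^+ 2 *: (X^T *m B *m X).
    have -> : (1%:M + t *: X)^T = 1%:M + t *: X^T by rewrite raddfD /= linearZ /= trmx1.
    rewrite mulmxDl mul1mx mulmxDr mulmx1 -scalemxAl -scalemxAr mulmxDl -scalemxAl.
    by rewrite !scalerDr scalerA -expr2 !addrA.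
  have := Bmin _ (transvection_symplectic v t).
  rewrite -subr_ge0 /symp_form KE trmx1 mul1mx mulmx1.
  rewrite !mulmxDr -!scalemxAr !mxtraceD !mxtraceZ mulmxDr mxtraceD.
  rewrite trB.
  have -> : \tr (Dmx w *m (B *m X)) = (v^T *m Z *m v) 0 0.
    rewrite /X /Z !mulmxA -(mulmxA _ v^T) mxtrace_mulC /mxtrace big_ord1.
    by rewrite !mulmxA.
  by congr (0 <= _); ring.
by rewrite -/Z -[RHS]opprK -(quad_form0_skew qZ) ZT opprK.
Qed.

Lemma diag_commute_eq0 (w : 'cV[R]_n) (P : 'M[R]_n) : injective (fun i => w i 0) ->
  diag_mx w^T *m P = P *m diag_mx w^T -> forall i j, i != j -> P i j = 0.
Proof.
move=> winj /matrixP E i j ij; move: (E i j).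
rewrite mul_diag_mx mul_mx_diag !mxE mulrC => /eqP.
rewrite -subr_eq0 -mulrBr mulf_eq0 subr_eq0 => /orP[/eqP //|/eqP/winj ijE].
by rewrite ijE eqxx in ij.
Qed.

(** Squaring shows that [B] commutes with [D_w^2], hence with its root [D_w], then with [J]. As the
    [w_i] are distinct, commuting with [D_w] makes the blocks of [B] diagonal. *)
Lemma commute_Jmx_Dmx_diag B w : B^T = B -> pos_vec w -> injective (fun i => w i 0) ->
  B *m (J *m Dmx w) = J *m Dmx w *m B -> exists x, B = Dmx x.
Proof.
move=> sB w0 winj BH.
have sqrtE : map_mx Num.sqrt (map_mx (fun t => t ^+ 2) (dbl w)) = dbl w.
  by apply/rowP => i; rewrite mxE mxE sqrtr_sqr ger0_norm// ltW// dbl_gt0.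
have Bw : Dmx w *m B = B *m Dmx w.
  have sqrD : Dmx w *m Dmx w = diag_mx (map_mx (fun t => t ^+ 2) (dbl w)).
    by rewrite DmxE mulmx_diag; congr diag_mx; apply/rowP => i; rewrite !mxE expr2.
  have := @Dmx_intertwine_sqr R n B w w; rewrite -BH mulmxA => /(_ erefl).
  by rewrite sqrD => /(diag_intertwine_map Num.sqrt); rewrite sqrtE -DmxE.
have BJ : J *m B = B *m J.
  have uw : Dmx w \in unitmx.
    rewrite unitmxE DmxE det_diag unitfE; apply/prodf_neq0 => i _.
    by rewrite gt_eqF// dbl_gt0.
  apply: (can_inj (mulmxK uw)); rewrite -mulmxA -Bw mulmxA -BH.
  by rewrite -mulmxA.
move: sB Bw BJ; rewrite -(submxK B).
move: (ulsubmx B) (ursubmx B) (dlsubmx B) (drsubmx B) => P Q S T.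
rewrite tr_block_mx /Dmx /Jmx !mulmx_block !mulmx0 !mul0mx !addr0 !add0r.
rewrite !mulNmx !mulmxN !mul1mx !mulmx1.
move=> /eq_block_mx[_ ST _ _] /eq_block_mx[Pw Qw _ _] /eq_block_mx[SQ TP _ _].
(* On the diagonal, symmetry of [B] gives [Q_ii = S_ii], while commutation with [J] gives
   [S = - Q]. *)
have Q0 : Q = 0.
  apply/matrixP => i j; rewrite [RHS]mxE.
  have [<-|ij] := eqVneq i j; last exact: (diag_commute_eq0 winj).
  have : Q i i = S i i by rewrite -ST mxE.
  by rewrite SQ [in RHS]mxE; lra.
exists (\col_i P i i); rewrite SQ TP Q0 oppr0.
suff PE : P = diag_mx (\col_i P i i)^T by rewrite /Dmx -PE.
apply/matrixP => i j; rewrite !mxE.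
have [->|ij] := eqVneq i j; first by rewrite mulr1n.
by rewrite mulr0n (diag_commute_eq0 winj).
Qed.

Definition perm_symp (s : 'S_n) : 'M[R]_(n + n) :=
  block_mx (perm_mx s) 0 0 (perm_mx s).

Lemma perm_mx_diag (s : 'S_n) y :
  perm_mx s *m diag_mx y^T *m (perm_mx s)^T = diag_mx (perm_mx s *m y)^T.
Proof.
rewrite -!row_permE tr_perm_mx -col_permE; apply/matrixP => i j.
by rewrite !mxE (inj_eq perm_inj).
Qed.

Lemma perm_symp_symplectic (s : 'S_n) : symplectic (perm_symp s)^T.
Proof.
rewrite /symplectic trmxK /perm_symp tr_block_mx !trmx0 /Jmx !mulmx_block.
rewrite !mulmx0 !mul0mx !addr0 !add0r !mulmxN !mulmx1 !mulNmx.
by rewrite tr_perm_mx -perm_mxM mulgV perm_mx1 !mul0mx.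
Qed.

Lemma perm_symp_Dmx (s : 'S_n) y :
  perm_symp s *m Dmx y *m (perm_symp s)^T = Dmx (perm_mx s *m y).
Proof.
rewrite /perm_symp /Dmx tr_block_mx !trmx0 !mulmx_block.
by rewrite !mulmx0 !mul0mx !addr0 !add0r !mul0mx !perm_mx_diag.
Qed.

Definition strictly_decreasing_vec w := forall i j : 'I_n, (i < j)%N -> w j 0 < w i 0.

(** Rearrangement: exchanging two wrongly ordered entries of [x] would lower the sum, and the
    exchange is realised by a symplectic permutation. *)
Lemma symp_form_min_sorted w x : strictly_decreasing_vec w ->
    (forall K, symplectic K -> symp_form (Dmx x) w 1%:M <= symp_form (Dmx x) w K) ->
  forall i j : 'I_n, (i <= j)%N -> x i 0 <= x j 0.
Proof.
move=> wdec xmin i j; rewrite leq_eqVlt => /orP[/eqP/val_inj -> //|ij].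
have := xmin _ (perm_symp_symplectic (tperm i j)).
rewrite /symp_form trmxK perm_symp_Dmx trmx1 mulmx1 mul1mx !mxtrace_DmxM.
rewrite ler_pM2l// -row_permE.
have jNi : j != i by rewrite gt_eqF.
rewrite (bigD1 i)//= (bigD1 j)//= [leRHS](bigD1 i)//= [X in _ <= _ + X](bigD1 j)//=.
rewrite !mxE tpermL tpermR !addrA.
rewrite [X in _ <= _ + X](eq_bigr (fun k => w k 0 * x k 0)); last first.
  by move=> k /andP[ki kj]; rewrite mxE tpermD// eq_sym.
rewrite lerD2r => H.
have := wdec i j ij => wji.
rewrite leNgt; apply/negP => xji.
have : 0 < (w i 0 - w j 0) * (x i 0 - x j 0) by rewrite mulr_gt0 ?subr_gt0.
lra.
Qed.

(** Passing to [M^T A M] for a minimiser [M] moves the minimum to the identity, where the critical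
    equation forces the form [D_x] and rearrangement sorts [x]. *)
Lemma williamson_of_weights A w : A^T = A -> pd_mx A -> pos_vec w ->
    strictly_decreasing_vec w ->
  exists2 x, williamson_vec A x &
    forall N, symplectic N -> 2 * \sum_i w i 0 * x i 0 <= symp_form A w N.
Proof.
move=> sA pA w0 wdec.
have [M HM Mmin] := symp_form_min_exists sA pA w0.
have uM := symplectic_unitmx HM.
have Bmin K : symplectic K ->
    symp_form (M^T *m A *m M) w 1%:M <= symp_form (M^T *m A *m M) w K.
  by move=> HK; rewrite -!symp_formM mulmx1; apply: Mmin; exact: symplecticM.
have winj : injective (fun i => w i 0).
  move=> i j wij; apply/val_inj.
  by case: (ltngtP i j) => // /wdec; rewrite wij ltxx.
have [x MAM] := commute_Jmx_Dmx_diag (tr_congr _ sA) w0 winj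
  (symp_form_critical (tr_congr _ sA) Bmin).
exists x; last first.
  move=> N /Mmin; apply: le_trans.
  by rewrite /symp_form MAM mxtrace_DmxM.
split; last by exists M.
- move=> i; have := pd_congr uM pA; rewrite MAM => /(_ (delta_mx (lshift n i) 0)).
  rewrite trmx_delta -rowE -colE DmxE mxE mxE mxE eqxx mulr1n /dbl row_mxEl mxE; apply.
  apply/eqP => /matrixP/(_ (lshift n i) 0); rewrite !mxE !eqxx => /eqP.
  by rewrite oner_eq0.
- by apply: symp_form_min_sorted wdec _ => K; rewrite -MAM; exact: Bmin.
Qed.

(** Since [y] may be unsorted, this serves both for uniqueness and for the matrices
    [N^-T D_y N^-1]. *)
Lemma williamson_vec_perm A x y : williamson_vec A x -> pos_vec y ->
  (exists2 M, symplectic M & M^T *m A *m M = Dmx y) ->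
  exists s : 'S_n, forall i, x i 0 = y (s i) 0.
Proof.
move=> [x0 _ [M HM MAM]] y0 [N HN NAN].
have uN := symplectic_unitmx HN.
apply: (@symplectic_Dmx_perm _ _ (invmx N *m M)) => //.
  by apply: symplecticM => //; exact: symplecticV.
rewrite -MAM -(congr_invmx uN NAN) trmx_mul.
by rewrite !mulmxA.
Qed.

Lemma williamson_vec_unique A x y :
  williamson_vec A x -> williamson_vec A y -> x = y.
Proof.
move=> Wx Wy; have [y0 ysort yM] := Wy.
have [s xs] := williamson_vec_perm Wx y0 yM.
have tuple_sorted (z : 'cV[R]_n) : (forall i j : 'I_n, (i <= j)%N -> z i 0 <= z j 0) ->
    path.sorted <=%O (tval [tuple z i 0 | i < n]).
  move=> zs; rewrite le_sorted_pairwise; apply/(pairwiseP 0) => i j.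
  rewrite !inE size_tuple => iltn jltn ij.
  rewrite -(tnth_nth 0 _ (Ordinal iltn)) -(tnth_nth 0 _ (Ordinal jltn)) !tnth_mktuple.
  by apply: zs; exact: ltnW.
have [_ xsort _] := Wx.
have E : [tuple x i 0 | i < n] = [tuple y i 0 | i < n].
  apply/val_inj/le_sorted_eq; [exact: tuple_sorted|exact: tuple_sorted|].
  apply/tuple_permP; exists s; congr val; apply: eq_from_tnth => i.
  by rewrite !tnth_mktuple xs.
apply/colP => i; have := congr1 (fun t => tnth t i) E.
by rewrite !tnth_mktuple.
Qed.

Lemma williamson_exists A : A^T = A -> pd_mx A -> exists x, williamson_vec A x.
Proof.
move=> sA pA.
(* Indices start at 0, so the weights [n - i] decrease strictly from [n] to 1. *)
have [||x Wx _] := @williamson_of_weights A (\col_i (n - i)%:R) sA pA.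
- by move=> i; rewrite mxE ltr0n subn_gt0.
- by move=> i j ij; rewrite !mxE ltr_nat ltn_sub2l.
- by exists x.
Qed.

Lemma symp_form_ge A w x N : A^T = A -> pd_mx A -> pos_vec w ->
    (forall i j : 'I_n, (i <= j)%N -> w j 0 <= w i 0) ->
    williamson_vec A x -> symplectic N ->
  2 * \sum_i w i 0 * x i 0 <= symp_form A w N.
Proof.
move=> sA pA w0 wdec Wx HN.
pose u : 'cV[R]_n := \col_i (n - i)%:R.
pose S (v : 'cV[R]_n) := 2 * \sum_i v i 0 * x i 0.
have main (e : R) : 0 < e -> S w + e * S u <= symp_form A w N + e * symp_form A u N.
  move=> e0.
  have [||y Wy] := @williamson_of_weights A (w + e *: u) sA pA.
  - by move=> i; rewrite !mxE ltr_wpDr ?mulr_ge0// ltW.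
  - move=> i j ij; rewrite !mxE ler_ltD ?wdec 1?ltnW//.
    by rewrite ltr_pM2l// ltr_nat ltn_sub2l.
  rewrite -(williamson_vec_unique Wx Wy) => /(_ N HN).
  rewrite /symp_form DmxD DmxZ mulmxDl -scalemxAl mxtraceD mxtraceZ; apply: le_trans.
  suff -> : 2 * \sum_i (w + e *: u) i 0 * x i 0 = S w + e * S u by [].
  rewrite /S [in RHS]mulrCA -mulrDr; congr (_ * _).
  rewrite mulr_sumr -big_split /=; apply: eq_bigr => i _.
  by rewrite !mxE mulrDl mulrA.
rewrite -/(S w) leNgt; apply/negP => lt_wS.
pose k := `|symp_form A u N - S u| + 1.
have k0 : 0 < k by rewrite ltr_wpDl.
(* For this [e] the perturbation makes up at most half of the supposed gap. *)
have := main ((S w - symp_form A w N) / (2 * k)).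
rewrite divr_gt0 ?subr_gt0 ?mulr_gt0// => /(_ isT).
set d := S w - _ in lt_wS *.
have d0 : 0 < d by rewrite subr_gt0.
have dk : 0 < d / (2 * k) by rewrite divr_gt0 ?mulr_gt0.
have : d / (2 * k) * (symp_form A u N - S u) <= d / (2 * k) * k.
  by rewrite ler_pM2l// (le_trans (ler_norm _))// lerDl.
have -> : d / (2 * k) * k = d / 2 by field; rewrite gt_eqF.
rewrite /d; lra.
Qed.

End Williamson.

(** * Asymptotic commutation *)

Section Domination.
Context {R : realType} {T : Type}.
Variables (P : T -> Prop) (e : T -> R).

(** [bounded_on] and [dominated_on] are O(1) and O(e), uniformly on [P]. The parameter type is left
    abstract: it will hold pairs of a matrix and one of its many diagonalisers. *)
Definition bounded_on m p (X : T -> 'M[R]_(m, p)) : Prop :=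
  exists2 k, 0 <= k & forall t, P t -> frob_norm (X t) <= k.

Definition dominated_on m p (X : T -> 'M[R]_(m, p)) : Prop :=
  exists2 k, 0 <= k & forall t, P t -> frob_norm (X t) <= k * e t.

Lemma bounded_on_cst m p (A : 'M[R]_(m, p)) : bounded_on (fun=> A).
Proof. by exists (frob_norm A); rewrite ?frob_norm_ge0. Qed.

Lemma bounded_on_tr m p (X : T -> 'M[R]_(m, p)) :
  bounded_on X -> bounded_on (fun t => (X t)^T).
Proof. by case=> k k0 Xk; exists k => // t Pt; rewrite frob_norm_tr Xk. Qed.

Lemma bounded_on_mul m p q (X : T -> 'M[R]_(m, p)) (Y : T -> 'M[R]_(p, q)) :
  bounded_on X -> bounded_on Y -> bounded_on (fun t => X t *m Y t).
Proof.
move=> [k k0 Xk] [l l0 Yl]; exists (k * l); rewrite ?mulr_ge0// => t Pt.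
by apply: le_trans (frob_normM _ _) _; rewrite ler_pM ?frob_norm_ge0 ?Xk ?Yl.
Qed.

Lemma dominated_add m p (X Y : T -> 'M[R]_(m, p)) :
  dominated_on X -> dominated_on Y -> dominated_on (fun t => X t + Y t).
Proof.
move=> [k k0 Xk] [l l0 Yl]; exists (k + l); rewrite ?addr_ge0// => t Pt.
by apply: le_trans (frob_normD _ _) _; rewrite mulrDl lerD ?Xk ?Yl.
Qed.

Lemma dominated_opp m p (X : T -> 'M[R]_(m, p)) :
  dominated_on X -> dominated_on (fun t => - X t).
Proof. by case=> k k0 Xk; exists k => // t Pt; rewrite frob_normN Xk. Qed.

Lemma dominated_mull m p q (X : T -> 'M[R]_(m, p)) (Y : T -> 'M[R]_(p, q)) :
  bounded_on X -> dominated_on Y -> dominated_on (fun t => X t *m Y t).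
Proof.
move=> [k k0 Xk] [l l0 Yl]; exists (k * l); rewrite ?mulr_ge0// => t Pt.
apply: le_trans (frob_normM _ _) _.
by rewrite -mulrA ler_pM ?frob_norm_ge0 ?Xk ?Yl.
Qed.

Lemma dominated_mulr m p q (X : T -> 'M[R]_(m, p)) (Y : T -> 'M[R]_(p, q)) :
  dominated_on X -> bounded_on Y -> dominated_on (fun t => X t *m Y t).
Proof.
move=> [k k0 Xk] [l l0 Yl]; exists (k * l); rewrite ?mulr_ge0// => t Pt.
apply: le_trans (frob_normM _ _) _.
by rewrite mulrAC ler_pM ?frob_norm_ge0 ?Xk ?Yl.
Qed.

Lemma dominated_eq m p (X Y : T -> 'M[R]_(m, p)) :
  (forall t, P t -> X t = Y t) -> dominated_on Y -> dominated_on X.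
Proof. by move=> XY [k k0 Yk]; exists k => // t Pt; rewrite XY// Yk. Qed.

Lemma dominated_entrywise m p (X Y : T -> 'M[R]_(m, p)) (c : R) : 0 <= c ->
    (forall t i j, P t -> `|X t i j| <= c * `|Y t i j|) ->
  dominated_on Y -> dominated_on X.
Proof.
move=> c0 XY [k k0 Yk]; exists (c * k); rewrite ?mulr_ge0// => t Pt.
rewrite -mulrA; apply: le_trans (ler_wpM2l c0 (Yk t Pt)).
rewrite -[leLHS]ger0_norm ?frob_norm_ge0// -[leRHS]ger0_norm; last first.
  by rewrite mulr_ge0 ?frob_norm_ge0.
rewrite -ler_sqr ?nnegrE ?normr_ge0// !real_normK ?num_real// exprMn !sqr_frob_norm.
rewrite !frob_dotE mulr_sumr; apply: ler_sum => j _.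
rewrite mulr_sumr; apply: ler_sum => i _.
rewrite -!expr2 -exprMn -[leLHS]real_normK ?num_real//.
rewrite -[leRHS]real_normK ?num_real// ler_sqr ?nnegrE ?normr_ge0//.
by rewrite normrM (ger0_norm c0) XY.
Qed.

End Domination.

(** * Matrices that almost commute with [J D_a] *)

Section CommutatorEstimates.
Context {R : realType} {n : nat} {T : Type}.
Variables (P : T -> Prop) (e : T -> R) (a : 'cV[R]_n) (K : T -> 'M[R]_(n + n)).
Local Notation J := (@Jmx R n).
Hypotheses (a0 : pos_vec a) (bK : bounded_on P K)
  (sK : forall t, P t -> symplectic (K t))
  (dE : dominated_on P e (fun t => J *m Dmx a *m K t - K t *m (J *m Dmx a))).

(** With [H = J D_a], so that [H^2 = - D_a^2], the Leibniz rule reads [[H^2, K] = H [H, K] + [H, K]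
    H]. *)
Lemma dominated_commutator_sqr :
  dominated_on P e (fun t => Dmx a *m Dmx a *m K t - K t *m (Dmx a *m Dmx a)).
Proof.
set H := J *m Dmx a.
have HH : H *m H = - (Dmx a *m Dmx a).
  by rewrite {1}/H Jmx_Dmx -mulmxA (mulmxA J J) Jmx_sqr mulNmx mul1mx mulmxN.
pose E t := H *m K t - K t *m H.
apply: (@dominated_eq _ _ _ _ _ _ _ (fun t => - (H *m E t + E t *m H))).
  move=> t _; rewrite /E mulmxBr mulmxBl (mulmxA H H) (mulmxA H (K t)) addrA subrK.
  rewrite HH -(mulmxA (K t) H) HH mulNmx mulmxN ?mulmxA.
  by rewrite opprB opprK addrC.
apply: dominated_opp; apply: dominated_add.
  by apply: dominated_mull => //; exact: bounded_on_cst.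
by apply: dominated_mulr => //; exact: bounded_on_cst.
Qed.

(** The condition for [D_w] to be a function of [D_a]. *)
Definition compatible (w : 'cV[R]_n) := forall i j, a i 0 = a j 0 -> w i 0 = w j 0.

(** A commutator with a diagonal matrix multiplies the entries of [K] by differences of diagonal
    entries, so it suffices to compare these differences for [w] and for the squares of [a]. *)
Lemma dominated_commutator w : compatible w ->
  dominated_on P e (fun t => Dmx w *m K t - K t *m Dmx w).
Proof.
move=> aw.
have [c c0 cw] : exists2 c, 0 <= c & forall i j,
    `|dbl w 0 i - dbl w 0 j| <= c * `|dbl a 0 i ^+ 2 - dbl a 0 j ^+ 2|.
  pose q (ij : 'I_(n + n) * 'I_(n + n)) :=
    `|dbl w 0 ij.1 - dbl w 0 ij.2| / `|dbl a 0 ij.1 ^+ 2 - dbl a 0 ij.2 ^+ 2|.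
  have q0 ij : 0 <= q ij by rewrite divr_ge0.
  (* The sum of all quotients dominates each of them; at ties of [a] compatibility gives
     [0 <= 0]. *)
  exists (\sum_ij q ij); first by rewrite sumr_ge0.
  move=> i j; have [aij|aij] := eqVneq (dbl a 0 i) (dbl a 0 j).
    suff -> : dbl w 0 i = dbl w 0 j by rewrite aij !subrr !normr0 mulr0.
    move: aij; rewrite /dbl !mxE; case: (splitP i) => k _; case: (splitP j) => l _;
    by rewrite !mxE => /aw.
  have a2 : 0 < `|dbl a 0 i ^+ 2 - dbl a 0 j ^+ 2|.
    by rewrite normr_gt0 subr_eq0 eqrXn2// ltW// dbl_gt0.
  rewrite -ler_pdivrMr// (bigD1 (i, j))//= lerDl sumr_ge0//.
apply: (dominated_entrywise c0 _ dominated_commutator_sqr) => t i j _.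
rewrite !DmxE mulmx_diag !mul_diag_mx !mul_mx_diag !mxE.
rewrite (mulrC _ (K t i j)) -mulrBr (mulrC _ (K t i j)) -mulrBr !normrM.
rewrite mulrCA ler_wpM2l//.
by have := cw i j; rewrite !expr2 /dbl !mxE.
Qed.

(** [[J, K] D_a = [J D_a, K] - J [D_a, K]], and [D_a] is invertible. *)
Lemma dominated_commutator_Jmx :
  dominated_on P e (fun t => J *m K t - K t *m J).
Proof.
have uA : Dmx a \in unitmx.
  rewrite unitmxE DmxE det_diag unitfE; apply/prodf_neq0 => i _.
  by rewrite gt_eqF// dbl_gt0.
pose E t := J *m Dmx a *m K t - K t *m (J *m Dmx a).
pose F t := Dmx a *m K t - K t *m Dmx a.
apply: (@dominated_eq _ _ _ _ _ _ _ (fun t => (E t - J *m F t) *m invmx (Dmx a))).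
  move=> t _; suff -> : E t - J *m F t = (J *m K t - K t *m J) *m Dmx a.
    by rewrite mulmxK.
  by rewrite /E /F mulmxBr mulmxBl !mulmxA opprB addrC addrA subrK.
apply: dominated_mulr; last exact: bounded_on_cst.
apply: dominated_add => //; apply: dominated_opp; apply: dominated_mull.
  exact: bounded_on_cst.
by apply: dominated_commutator.
Qed.

(** From [K J K^T = J] follows [1 - K K^T = J [J, K] K^T], so [K] is nearly orthogonal; and [K D_w
    K^T = D_w K K^T - [D_w, K] K^T]. *)
Lemma dominated_congr_Dmx w : compatible w ->
  dominated_on P e (fun t => K t *m Dmx w *m (K t)^T - Dmx w).
Proof.
move=> aw.
pose F t := Dmx w *m K t - K t *m Dmx w.
pose G t := J *m K t - K t *m J.
apply: (@dominated_eq _ _ _ _ _ _ _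
  (fun t => - (F t *m (K t)^T) + - (Dmx w *m (J *m (G t *m (K t)^T))))).
  move=> t Pt; have KJ := symplectic_tr (sK Pt).
  have -> : J *m (G t *m (K t)^T) = 1%:M - K t *m (K t)^T.
    rewrite /G mulmxBl KJ mulmxBr Jmx_sqr opprK -(mulmxA J) (mulmxA J J) Jmx_sqr.
    by rewrite mulNmx mul1mx addrC.
  rewrite /F mulmxBl mulmxBr mulmx1 !opprB mulmxA addrA.
  by rewrite subrK.
have bKT := bounded_on_tr bK.
apply: dominated_add; apply: dominated_opp.
  by apply: dominated_mulr => //; exact: dominated_commutator.
do 2![apply: dominated_mull; first exact: bounded_on_cst].
by apply: dominated_mulr => //; exact: dominated_commutator_Jmx.
Qed.

End CommutatorEstimates.

(** * Local behaviour of the symplectic eigenvalues *)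

Section EigenvaluePerturbation.
Context {R : realType} {n : nat}.
Implicit Types (A B C : sym_mx R (n + n)) (M N : 'M[R]_(n + n)) (w : 'cV[R]_n).
Local Notation J := (@Jmx R n).
Local Notation d := (@symplectic_eigenvalues R n).

Lemma sym_mx_tr m (B : sym_mx R m) : (B : 'M[R]_m)^T = B.
Proof. exact/is_sym_mxP/sym_valP. Qed.

Lemma sym_normE m (B : sym_mx R m) : `|B| = frob_norm B.
Proof. by []. Qed.

Lemma symplectic_eigenvaluesP B : posdef B -> williamson_vec B (d B).
Proof.
move=> pB; rewrite /symplectic_eigenvalues; apply: xgetPex.
exact: williamson_exists (sym_mx_tr B) pB.
Qed.

Definition diagonalizes B M := symplectic M /\ M^T *m B *m M = Dmx (d B).

Lemma diagonalizes_exists B : posdef B -> exists M, diagonalizes B M.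
Proof. by move=> /symplectic_eigenvaluesP[_ _ [M]]; exists M. Qed.

(** Half of the coercivity constant absorbs the perturbation, leaving a constant uniform in [B]. *)
Lemma posdef_near m (A : sym_mx R m) : posdef A ->
  exists del c : R, [/\ 0 < del, 0 < c & forall B : sym_mx R m, `|B - A| < del ->
    forall x : 'cV_m, c * frob_dot x x <= (x^T *m B *m x) 0 0].
Proof.
move=> pA; have [c c0 cA] := pd_coercive (sym_mx_tr A) pA.
exists (c / 2), (c / 2); split; rewrite ?divr_gt0// => B BA x.
have -> : (B : 'M[R]_m) = A + (B - A : sym_mx R m) by rewrite /= addrC subrK.
rewrite !quad_form_frob mulmxDl frob_dotDr -quad_form_frob.
have : `|frob_dot x ((B - A : sym_mx R m) *m x)| <= c / 2 * frob_dot x x.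
  apply: le_trans (frob_dot_le _ _) _.
  rewrite -sqr_frob_norm expr2 mulrCA ler_wpM2l ?frob_norm_ge0//.
  apply: le_trans (frob_normM _ _) _; rewrite ler_wpM2r ?frob_norm_ge0//.
  by rewrite -sym_normE ltW.
rewrite ler_norml => /andP[+ _]; have := cA x; lra.
Qed.

Lemma posdef_of_coercive m (B : sym_mx R m) (c : R) : 0 < c ->
  (forall x : 'cV_m, c * frob_dot x x <= (x^T *m B *m x) 0 0) -> posdef B.
Proof.
move=> c0 cB x x0; apply: lt_le_trans (cB x); rewrite mulr_gt0//.
by rewrite lt_def frob_dot_ge0 andbT; apply: contra x0 => /eqP/frob_dot_eq0 ->.
Qed.

Lemma symp_form_diagonalizes B M w : diagonalizes B M ->
  symp_form B w M = 2 * \sum_i w i 0 * d B i 0.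
Proof. by move=> [_ MBM]; rewrite /symp_form MBM mxtrace_DmxM. Qed.

(** With all weights 1, coercivity bounds [|M|^2] by a multiple of [tr (M^T B M)], which is the
    minimum of the trace and so at most its value [tr B] at the identity. *)
Lemma local_bound A : posdef A -> exists del b : R, [/\ 0 < del, 0 <= b &
  forall B, `|B - A| < del ->
    posdef B /\ forall M, diagonalizes B M -> frob_norm M <= b].
Proof.
move=> pA; have [del [c [del0 c0 cA]]] := posdef_near pA.
pose k := c^-1 * (frob_norm (Dmx (const_mx 1 : 'cV[R]_n)) * (`|A| + del)).
exists del, (Num.sqrt k); split; rewrite ?sqrtr_ge0// => B BA.
have pB := posdef_of_coercive c0 (cA B BA); split=> // M dM.
rewrite -[leLHS]ger0_norm ?frob_norm_ge0// -sqrtr_sqr ler_wsqrtr//.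
rewrite /k -ler_pdivrMl ?invr_gt0// invrK.
apply: (@le_trans _ _ (symp_form B (const_mx 1) M)).
  rewrite symp_form_sum sqr_frob_norm frob_dotE mulr_sumr; apply: ler_sum => j _.
  have -> : dbl (const_mx 1 : 'cV[R]_n) 0 j = 1.
    by rewrite /dbl mxE; case: splitP => k' _; rewrite !mxE.
  rewrite mul1r; apply: le_trans (cA B BA _).
  by rewrite frob_dotE big_ord1; under [in leRHS]eq_bigr do rewrite !mxE.
rewrite symp_form_diagonalizes//.
apply: (@le_trans _ _ (symp_form B (const_mx 1) 1%:M)).
  apply: symp_form_ge; [exact: sym_mx_tr|exact: pB| | |
    exact: symplectic_eigenvaluesP|exact: symplectic1].
    by move=> i; rewrite mxE.
  by move=> i j _; rewrite !mxE.
rewrite symp_form_frob ?sym_mx_tr// trmx1 mul1mx mulmx1.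
apply: le_trans (ler_norm _) _; apply: le_trans (frob_dot_le _ _) _.
rewrite ler_wpM2l ?frob_norm_ge0// -sym_normE -{1}(subrK A B) addrC.
by apply: le_trans (ler_normD _ _) _; rewrite lerD2l ltW.
Qed.

Definition antitone_weight w : Prop :=
  pos_vec w /\ forall i j : 'I_n, (i <= j)%N -> w j 0 <= w i 0.

(* A diagonalizer of [B] is a competitor in the minimum principle for [C]. *)
Lemma eigenvalue_sum_diff_le B C M w : antitone_weight w ->
    posdef B -> posdef C -> diagonalizes B M ->
  2 * \sum_i w i 0 * (d C i 0 - d B i 0) <=
    frob_dot (M *m Dmx w *m M^T) (C - B : sym_mx R (n + n)).
Proof.
move=> [w0 wdec] pB pC dM.
have := symp_form_ge (sym_mx_tr C) pC w0 wdec (symplectic_eigenvaluesP pC) dM.1.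
have := symp_form_diagonalizes w dM.
rewrite !symp_form_frob ?sym_mx_tr// => EB.
have -> : (C : 'M[R]_(n + n)) = (C - B : sym_mx R (n + n)) + B :> 'M[R]_(n + n).
  by rewrite /= subrK.
rewrite frob_dotDr EB -lerBlDr -mulrBr -sumrB.
by under [in X in X -> _]eq_bigr do rewrite -mulrBr.
Qed.

Lemma eigenvalue_sum_lipschitz A w : posdef A -> antitone_weight w ->
  exists del k : R, [/\ 0 < del, 0 <= k & forall B C,
    `|B - A| < del -> `|C - A| < del ->
    `|\sum_i w i 0 * (d C i 0 - d B i 0)| <= k * `|C - B|].
Proof.
move=> pA aw; have [del [b [del0 b0 bA]]] := local_bound pA.
pose k := b * frob_norm (Dmx w) * b.
have k0 : 0 <= k by rewrite !mulr_ge0 ?frob_norm_ge0.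
have main B C : `|B - A| < del -> `|C - A| < del ->
    \sum_i w i 0 * (d C i 0 - d B i 0) <= k * `|C - B|.
  move=> /bA[pB bB] /bA[pC _]; have [M dM] := diagonalizes_exists pB.
  apply: (@le_trans _ _ (2 * (k * `|C - B|) / 2)); last by lra.
  rewrite ler_pdivlMr// mulrC; apply: le_trans (eigenvalue_sum_diff_le aw pB pC dM) _.
  apply: le_trans (ler_norm _) _; apply: le_trans (frob_dot_le _ _) _.
  rewrite -sym_normE; apply: (@le_trans _ _ (k * `|C - B|)); last first.
    have : 0 <= k * `|C - B| by rewrite mulr_ge0.
    lra.
  rewrite ler_wpM2r//; apply: le_trans (frob_normM _ _) _.
  rewrite frob_norm_tr ler_pM ?frob_norm_ge0 ?bB//.
  apply: le_trans (frob_normM _ _) _.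
  by rewrite ler_wpM2r ?frob_norm_ge0 ?bB.
exists del, k; split; [exact: del0|exact: k0|move=> B C BA CA].
rewrite ler_norml (main _ _ BA CA) andbT.
have := main C B CA BA; rewrite distrC => H.
rewrite lerNl -sumrN; apply: le_trans H.
rewrite le_eqVlt; apply/orP; left; apply/eqP; apply: eq_bigr => i _.
by rewrite -mulrN opprB.
Qed.

Lemma frob_norm_col_le (x : 'cV[R]_n) : frob_norm x <= \sum_i `|x i 0|.
Proof.
have s0 : 0 <= \sum_i `|x i 0| by exact: sumr_ge0.
rewrite -[leLHS]ger0_norm ?frob_norm_ge0// -[leRHS]ger0_norm//.
rewrite -ler_sqr ?nnegrE ?normr_ge0// !real_normK ?num_real//.
rewrite sqr_frob_norm frob_dotE big_ord1 expr2 mulr_suml; apply: ler_sum => i _.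
rewrite -expr2 -real_normK ?num_real// expr2 ler_wpM2l//.
by rewrite (bigD1 i)//= lerDl sumr_ge0.
Qed.

(** Each [d_k] is a difference of two weighted sums, with weights [u + e_k] and [u]. The entries of
    [u] fall in steps of 1, so raising one of them by 1 creates at most a tie. *)
Lemma symplectic_eigenvalues_lipschitz A : posdef A ->
  exists del k : R, [/\ 0 < del, 0 <= k & forall B C,
    `|B - A| < del -> `|C - A| < del -> `|d C - d B| <= k * `|C - B|].
Proof.
move=> pA.
pose u : 'cV[R]_n := \col_i (n - i)%:R.
have u0 : antitone_weight u.
  split=> [i|i j ij]; rewrite !mxE ?ltr0n ?subn_gt0//.
  by rewrite ler_nat leq_sub2l.
have uk k : antitone_weight (u + delta_mx k 0).
  split=> [i|i j ij]; rewrite !mxE.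
    by rewrite ltr_wpDr ?ler0n// ltr0n subn_gt0.
  rewrite !andbT -!natrD ler_nat.
  have [<-|jk] := eqVneq j k; last first.
    by rewrite addn0 (leq_trans (leq_sub2l n ij))// leq_addr.
  have [->//|jNi] := eqVneq i j.
  have ltij : (i < j)%N by rewrite ltn_neqAle ij andbT.
  by rewrite addn0 addn1 ltn_sub2l// (ltn_trans ltij).
have comp k : exists dk : R * R, [/\ 0 < dk.1, 0 <= dk.2 & forall B C,
    `|B - A| < dk.1 -> `|C - A| < dk.1 -> `|d C k 0 - d B k 0| <= dk.2 * `|C - B|].
  have [d1 [k1 [d10 k10 H1]]] := eigenvalue_sum_lipschitz pA (uk k).
  have [d2 [k2 [d20 k20 H2]]] := eigenvalue_sum_lipschitz pA u0.
  exists (Num.min d1 d2, k1 + k2); split=> [||B C] /=; first by rewrite lt_min d10.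
    by rewrite addr_ge0.
  move=> /lt_min_and[B1 B2] /lt_min_and[C1 C2].
  have := H1 B C B1 C1; have := H2 B C B2 C2.
  rewrite [X in _ -> `|X| <= _ -> _](_ : _ = \sum_i u i 0 * (d C i 0 - d B i 0) +
      (d C k 0 - d B k 0)); last first.
    under eq_bigr do rewrite mxE mulrDl; rewrite big_split /=; congr (_ + _).
    rewrite (bigD1 k)//= big1 ?addr0; first by rewrite mxE !eqxx mul1r.
    by move=> i ik; rewrite mxE (negbTE ik) mul0r.
  set s := \sum_i _; set t := d C k 0 - _ => Hs Hst.
  have -> : t = (s + t) - s by rewrite addrC addKr.
  by apply: le_trans (ler_normB _ _) _; rewrite mulrDl lerD.
have [q Hq] := choice comp.
have [del del0 Hdel] : exists2 del, 0 < del & forall k, del <= (q k).1.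
  have [|c c0 cq] := @row_lower_bound R n (\row_k (q k).1).
    by move=> k; rewrite mxE; case: (Hq k).
  by exists c => // k; have := cq k; rewrite mxE.
exists del, (\sum_k (q k).2); split=> //.
  by apply: sumr_ge0 => k _; case: (Hq k).
move=> B C BA CA; apply: le_trans (frob_norm_col_le _) _.
rewrite mulr_suml; apply: ler_sum => k _; have [_ _ H] := Hq k.
rewrite !mxE; apply: H; [exact: lt_le_trans BA (Hdel k)|].
exact: lt_le_trans CA (Hdel k).
Qed.

End EigenvaluePerturbation.

(** * Strict differentiability of weighted sums of symplectic eigenvalues *)

Section WeightedSums.
Context {R : realType} {n : nat}.
Implicit Types (A B C : sym_mx R (n + n)) (M N : 'M[R]_(n + n)) (w g : 'cV[R]_n).
Local Notation J := (@Jmx R n).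
Local Notation d := (@symplectic_eigenvalues R n).

Lemma frob_norm_Dmx_le (x : 'cV[R]_n) : frob_norm (Dmx x) <= 2 * frob_norm x.
Proof.
have f0 := frob_norm_ge0 x.
rewrite -[leLHS]ger0_norm ?frob_norm_ge0// -[leRHS]ger0_norm ?mulr_ge0//.
rewrite -ler_sqr ?nnegrE ?normr_ge0// !real_normK ?num_real// exprMn !sqr_frob_norm.
rewrite /frob_dot Dmx_tr mxtrace_DmxM -/(frob_dot x x) frob_dotE big_ord1.
have : 0 <= \sum_i x i 0 * x i 0 by apply: sumr_ge0 => i _; rewrite -expr2 sqr_ge0.
lra.
Qed.

(** Diagonalisers are not unique and need not converge, but [M D_w M^T] does. The comparison goes
    through [K = N^-1 M], which nearly commutes with [J D_a] for [a = d(A)]. *)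
Lemma diagonalizers_near A N w : posdef A -> diagonalizes A N ->
    compatible (d A) w ->
  exists del k : R, [/\ 0 < del, 0 <= k & forall B M, `|B - A| < del ->
    diagonalizes B M ->
    frob_norm (M *m Dmx w *m M^T - N *m Dmx w *m N^T) <= k * `|B - A|].
Proof.
move=> pA [sN NAN] cw.
have [d1 [b [d10 b0 bA]]] := local_bound pA.
have [d2 [l [d20 l0 lA]]] := symplectic_eigenvalues_lipschitz pA.
have uN := symplectic_unitmx sN.
pose P (t : sym_mx R (n + n) * 'M[R]_(n + n)) :=
  `|t.1 - A| < Num.min d1 d2 /\ diagonalizes t.1 t.2.
pose e (t : sym_mx R (n + n) * 'M[R]_(n + n)) := `|t.1 - A|.
pose K (t : sym_mx R (n + n) * 'M[R]_(n + n)) := invmx N *m t.2.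
have [a0 _ _] := symplectic_eigenvaluesP pA.
have bK : bounded_on P K.
  apply: (@bounded_on_mul _ _ _ _ _ _ (fun=> invmx N) snd); first exact: bounded_on_cst.
  exists b => // -[B M] [/=] /lt_min_and[/bA[_ H] _]; exact: H.
have sK t : P t -> symplectic (K t).
  by move=> [_ [sM _]]; apply: symplecticM => //; exact: symplecticV.
have dB : dominated_on P e (fun t => (t.1 - A : sym_mx R (n + n)) : 'M[R]_(n + n)).
  by exists 1 => // t _; rewrite mul1r.
have dD : dominated_on P e (fun t => Dmx (d t.1 - d A)).
  exists (2 * l); first by rewrite mulr_ge0.
  move=> [B M] [/=] /lt_min_and[_ BA] _.
  apply: le_trans (frob_norm_Dmx_le _) _; rewrite -mulrA ler_wpM2l//.
  by apply: lA BA; rewrite subrr normr0.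
have dE : dominated_on P e
    (fun t => J *m Dmx (d A) *m K t - K t *m (J *m Dmx (d A))).
  (* [K] intertwines [J N^T B N] with [J D_b], [b = d(B)]; replacing both by [J D_a] costs a term in
     [B - A] and one in [b - a], the latter controlled by the Lipschitz bound. *)
  apply: (@dominated_eq _ _ _ _ _ _ _ (fun t =>
    - (J *m (N^T *m (t.1 - A : sym_mx R (n + n)) *m N) *m K t) +
    K t *m J *m Dmx (d t.1 - d A))).
    move=> [B M] [/= _ [sM MBM]]; rewrite /K /=.
    have E : J *m (N^T *m B *m N) *m (invmx N *m M) =
        invmx N *m M *m J *m Dmx (d B).
      apply: symplectic_intertwine.
        by apply: symplecticM; first exact: symplecticV.
      rewrite trmx_mul !mulmxA -(mulmxA M^T) -trmx_mul mulmxV// trmx1 mulmx1.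
      by rewrite mulmxK.
    have -> : N^T *m (B - A : sym_mx R (n + n)) *m N = N^T *m B *m N - Dmx (d A).
      by rewrite -NAN -mulmxBl -mulmxBr.
    have -> : Dmx (d B - d A) = Dmx (d B) - Dmx (d A).
      by rewrite -scaleN1r DmxD DmxZ scaleN1r.
    rewrite [J *m (_ - _)]mulmxBr mulmxBl E mulmxBr opprB -!mulmxA addrA.
    by rewrite subrK.
  apply: dominated_add; last first.
    apply: (@dominated_mull _ _ _ _ _ _ _ (fun t => K t *m J)) dD.
    by apply: bounded_on_mul bK _; exact: bounded_on_cst.
  apply: dominated_opp.
  apply: (@dominated_mulr _ _ _ _ _ _ _ (fun t =>
    J *m (N^T *m (t.1 - A : sym_mx R (n + n)) *m N))) bK.
  apply: (@dominated_mull _ _ _ _ _ _ _ (fun=> J)); first exact: bounded_on_cst.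
  apply: (@dominated_mulr _ _ _ _ _ _ _ (fun t =>
    N^T *m (t.1 - A : sym_mx R (n + n))) (fun=> N)); last exact: bounded_on_cst.
  by apply: (@dominated_mull _ _ _ _ _ _ _ (fun=> N^T)) dB; exact: bounded_on_cst.
have := dominated_congr_Dmx a0 bK sK dE cw.
move=> H; have : dominated_on P e (fun t =>
    N *m (K t *m Dmx w *m (K t)^T - Dmx w) *m N^T).
  apply: (@dominated_mulr _ _ _ _ _ _ _ (fun t =>
    N *m (K t *m Dmx w *m (K t)^T - Dmx w)) (fun=> N^T)); last exact: bounded_on_cst.
  by apply: (@dominated_mull _ _ _ _ _ _ _ (fun=> N)) H; exact: bounded_on_cst.
move=> [k k0 Hk]; exists (Num.min d1 d2), k; split=> // [|B M BA dM].
  by rewrite lt_min d10.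
have := Hk (B, M) (conj BA dM); rewrite /e /K /=.
rewrite mulmxBr mulmxBl trmx_mul !mulmxA mulmxV// mul1mx.
by rewrite -!mulmxA -trmx_mul mulmxV// trmx1 mulmx1.
Qed.

(** A diagonaliser of [B] gives the upper estimate, one of [C] the lower; both resulting matrices
    are close to [N D_w N^T], whence the two error terms. *)
Lemma eigenvalue_sum_strict A N w : posdef A -> diagonalizes A N ->
    antitone_weight w -> compatible (d A) w ->
  exists del k : R, [/\ 0 < del, 0 <= k & forall B C,
    `|B - A| < del -> `|C - A| < del ->
    `|2 * \sum_i w i 0 * (d C i 0 - d B i 0) -
      frob_dot (N *m Dmx w *m N^T) (C - B : sym_mx R (n + n))|
      <= k * (`|B - A| + `|C - A|) * `|C - B|].
Proof.
move=> pA dN aw cw.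
have [d1 [k [d10 k0 kA]]] := diagonalizers_near pA dN cw.
have [d2 [b [d20 b0 bA]]] := local_bound pA.
set G := N *m Dmx w *m N^T.
have main B C : `|B - A| < Num.min d1 d2 -> `|C - A| < Num.min d1 d2 ->
    2 * \sum_i w i 0 * (d C i 0 - d B i 0) -
      frob_dot G (C - B : sym_mx R (n + n)) <= k * `|B - A| * `|C - B|.
  move=> /lt_min_and[B1 /bA[pB _]] /lt_min_and[_ /bA[pC _]].
  have [M dM] := diagonalizes_exists pB.
  have H := eigenvalue_sum_diff_le aw pB pC dM.
  have : `|frob_dot (M *m Dmx w *m M^T - G) (C - B : sym_mx R (n + n))|
      <= k * `|B - A| * `|C - B|.
    apply: le_trans (frob_dot_le _ _) _; rewrite -sym_normE ler_wpM2r//.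
    exact: kA.
  rewrite ler_norml frob_dotBl => /andP[_].
  lra.
exists (Num.min d1 d2), k; split=> // [|B C BA CA]; first by rewrite lt_min d10.
rewrite mulrDr mulrDl; apply: two_sided_bound (main B C BA CA) _.
- by rewrite !mulr_ge0.
- by rewrite !mulr_ge0.
have := main C B CA BA; rewrite [X in _ <= _ * X]distrC.
have -> : \sum_i w i 0 * (d B i 0 - d C i 0) = - \sum_i w i 0 * (d C i 0 - d B i 0).
  by rewrite -sumrN; apply: eq_bigr => i _; rewrite -mulrN opprB.
have -> : frob_dot G (B - C : sym_mx R (n + n)) = - frob_dot G (C - B : sym_mx R (n + n)).
  by rewrite /= -opprB -scaleN1r frob_dotZr mulN1r.
exact.
Qed.

(* A weight that is compatible with the ties of [d A] is a difference of two
   antitone ones, obtained by adding a large multiple of [- d A]. *)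
Lemma compatible_decomposition A g : posdef A -> compatible (d A) g ->
  exists w1 w2, [/\ g = w1 - w2, antitone_weight w1 /\ compatible (d A) w1 &
    antitone_weight w2 /\ compatible (d A) w2].
Proof.
move=> pA cg; have [a0 asort _] := symplectic_eigenvaluesP pA.
pose q (ij : 'I_n * 'I_n) := `|(g ij.1 0 - g ij.2 0) / (d A ij.1 0 - d A ij.2 0)|.
pose c := 1 + \sum_ij q ij.
have c0 : 0 < c by rewrite ltr_pwDl ?sumr_ge0// => ij _; rewrite normr_ge0.
have cq i j : `|g i 0 - g j 0| <= c * `|d A i 0 - d A j 0|.
  have [aij|aij] := eqVneq (d A i 0) (d A j 0).
    by rewrite (cg _ _ aij) aij !subrr !normr0 mulr0.
  rewrite -ler_pdivrMr ?normr_gt0 ?subr_eq0// -normf_div.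
  apply: (@le_trans _ _ (\sum_ij q ij)); last by rewrite lerDr.
  by rewrite (bigD1 (i, j))//= lerDl sumr_ge0// => ij _; rewrite normr_ge0.
(* [m] is large enough to make [w2] and [g + w2] positive, while the slope [c] outweighs the
   variation of [g], so that [g + w2] is antitone. *)
pose m := 1 + \sum_i (c * d A i 0 + `|g i 0|).
have m1 i : c * d A i 0 + `|g i 0| < m.
  rewrite /m (bigD1 i)//= addrCA ltrDl ltr_pwDl// sumr_ge0// => k _.
  by rewrite addr_ge0// mulr_ge0// ltW.
pose w2 : 'cV[R]_n := \col_i (m - c * d A i 0).
have w2E i : w2 i 0 = m - c * d A i 0 by rewrite mxE.
exists (g + w2), w2; split; first by rewrite addrK.
- split; first split=> [i|i j ij].
  + rewrite mxE w2E; have := m1 i; have := lerNnormlW (lexx `|g i 0|); lra.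
  + rewrite mxE [leRHS]mxE !w2E.
    have := cq i j; rewrite ler_norml distrC (ger0_norm _) ?subr_ge0 ?asort//.
    by move=> /andP[+ _]; lra.
  + by move=> i j aij; rewrite mxE [RHS]mxE !w2E aij (cg _ _ aij).
- split; first split=> [i|i j ij].
  + by rewrite w2E subr_gt0 (le_lt_trans _ (m1 i))// lerDl.
  + by rewrite !w2E lerD2l lerN2 ler_wpM2l ?asort// ltW.
  + by move=> i j aij; rewrite !w2E aij.
Qed.

Lemma eigenvalue_sum_strict_compatible A N g : posdef A -> diagonalizes A N ->
    compatible (d A) g ->
  exists del k : R, [/\ 0 < del, 0 <= k & forall B C,
    `|B - A| < del -> `|C - A| < del ->
    `|2 * \sum_i g i 0 * (d C i 0 - d B i 0) -
      frob_dot (N *m Dmx g *m N^T) (C - B : sym_mx R (n + n))|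
      <= k * (`|B - A| + `|C - A|) * `|C - B|].
Proof.
move=> pA dN cg; have [w1 [w2 [gE [a1 c1] [a2 c2]]]] := compatible_decomposition pA cg.
have [d1 [k1 [d10 k10 H1]]] := eigenvalue_sum_strict pA dN a1 c1.
have [d2 [k2 [d20 k20 H2]]] := eigenvalue_sum_strict pA dN a2 c2.
exists (Num.min d1 d2), (k1 + k2); split=> [||B C].
- by rewrite lt_min d10.
- by rewrite addr_ge0.
move=> /lt_min_and[B1 B2] /lt_min_and[C1 C2].
have := H1 B C B1 C1; have := H2 B C B2 C2.
have -> : \sum_i g i 0 * (d C i 0 - d B i 0) =
    \sum_i w1 i 0 * (d C i 0 - d B i 0) - \sum_i w2 i 0 * (d C i 0 - d B i 0).
  by rewrite -sumrB; apply: eq_bigr => i _; rewrite gE !mxE mulrBl.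
have -> : N *m Dmx g *m N^T = N *m Dmx w1 *m N^T + (-1) *: (N *m Dmx w2 *m N^T).
  by rewrite gE -[in LHS]scaleN1r DmxD DmxZ mulmxDr mulmxDl -scalemxAr -scalemxAl.
rewrite frob_dotDl frob_dotZl.
set s1 := \sum_i w1 i 0 * _; set s2 := \sum_i w2 i 0 * _.
set f1 := frob_dot (_ *m Dmx w1 *m _) _; set f2 := frob_dot (_ *m Dmx w2 *m _) _ => E2 E1.
clearbody s1 s2 f1 f2.
have -> : 2 * (s1 - s2) - (f1 + -1 * f2) = (2 * s1 - f1) - (2 * s2 - f2) by ring.
apply: le_trans (ler_normB _ _) _.
by rewrite !mulrDl lerD -?mulrDl.
Qed.

End WeightedSums.

(** * Transfer between [f] and its composite with the eigenvalues *)

Section FrobeniusForm.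
Context {R : realType} {m : nat}.

(** For [G = N D_g N^T], with [g] the gradient of [f], this is the derivative of [f o d]; the half
    compensates for each entry of [g] occurring twice in [D_g]. *)
Definition half_frob_form (G : 'M[R]_m) (U : sym_mx R m) : R := 2^-1 * frob_dot G U.

Lemma half_frob_form_linear G : linear (half_frob_form G).
Proof.
by move=> k U V; rewrite /half_frob_form /= frob_dotDr frob_dotZr mulrDr mulrCA.
Qed.

HB.instance Definition _ G :=
  GRing.isLinear.Build R (sym_mx R m) R _ (half_frob_form G) (half_frob_form_linear G).

Lemma half_frob_form_continuous G : continuous (half_frob_form G).
Proof.
apply: (@bounded_linear_continuous _ _ _ _ (2^-1 * frob_norm G)) => U.
by rewrite /half_frob_form normrM ger0_norm// -mulrA ler_wpM2l// frob_dot_le.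
Qed.

End FrobeniusForm.

Section CongruenceOfDmx.
Context {R : realType} {n : nat}.

Implicit Types N : 'M[R]_(n + n).

Lemma congr_Dmx_sym N (y : 'cV[R]_n) : N^T *m Dmx y *m N \in is_sym_mx.
Proof. by apply/is_sym_mxP; rewrite tr_congr// Dmx_tr. Qed.

(** Used at [invmx N] with [N] diagonalising [A], where it takes the value [A] at [d(A)]. *)
Definition congr_Dmx N (y : euclid R n) : sym_mx R (n + n) := SymMx (congr_Dmx_sym N y).

Lemma congr_Dmx_linear N : linear (congr_Dmx N).
Proof.
move=> k x y; apply: val_inj => /=.
by rewrite DmxD DmxZ mulmxDr mulmxDl -scalemxAr -scalemxAl.
Qed.

HB.instance Definition _ N :=
  GRing.isLinear.Build R (euclid R n) (sym_mx R (n + n)) _ (congr_Dmx N)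
    (congr_Dmx_linear N).

Lemma congr_Dmx_bounded N : exists2 k : R, 0 <= k &
  forall y : euclid R n, `|congr_Dmx N y| <= k * `|y|.
Proof.
exists (frob_norm N * 2 * frob_norm N); first by rewrite !mulr_ge0 ?frob_norm_ge0.
move=> y; rewrite sym_normE /=; apply: le_trans (frob_normM _ _) _.
rewrite mulrAC ler_wpM2r ?frob_norm_ge0//; apply: le_trans (frob_normM _ _) _.
by rewrite frob_norm_tr -mulrA ler_wpM2l ?frob_norm_ge0 ?frob_norm_Dmx_le.
Qed.

End CongruenceOfDmx.

Section Transfer.
Context {R : realType} {n : nat} (f : euclid R n -> R) (f_sym : symmetric_fun f).
Local Notation d := (@symplectic_eigenvalues R n).

Lemma euclid_normE (x : euclid R n) : `|x| = frob_norm (x : 'cV[R]_n).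
Proof. by []. Qed.

(** Keeps arguments in the region where [f] is known to be symmetric. *)
Lemma pos_vec_near (a : euclid R n) : pos_vec a ->
  exists2 del : R, 0 < del & forall y : euclid R n, `|y - a| < del -> pos_vec y.
Proof.
move=> a0; have [|c c0 ca] := @row_lower_bound R n a^T.
  by move=> j; rewrite mxE.
exists c => // y ya i; have := ca i; rewrite mxE.
have := entry_le_frob_norm (y - a : 'cV[R]_n) i 0; rewrite -euclid_normE.
move=> /le_lt_trans/(_ ya); rewrite !mxE ltr_norml => /andP[+ _]; lra.
Qed.

Definition gradient (L : euclid R n -> R) : 'cV[R]_n := \col_i L (delta_mx i 0).

Lemma gradientE (L : {linear euclid R n -> R}) (u : euclid R n) :
  L u = \sum_i gradient L i 0 * u i 0.
Proof.
have {1}-> : u = \sum_i u i 0 *: (delta_mx i 0 : euclid R n).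
  apply/colP => j; rewrite summxE (bigD1 j)//= big1.
    by rewrite !mxE !eqxx mulr1 addr0.
  by move=> i ij; rewrite !mxE eq_sym (negbTE ij) mulr0.
by rewrite linear_sum; apply: eq_bigr => i _; rewrite linearZ mxE mulrC.
Qed.

(** If [a_i = a_j], exchanging the two indices fixes [a] and carries [a + t e_i] to [a + t e_j], so
    [f] has equal increments in both directions. *)
Lemma gradient_compatible (L : {linear euclid R n -> R}) (a : euclid R n) :
  pos_vec a -> strict_approx f L a -> compatible a (gradient L).
Proof.
move=> a0 fL i j aij; rewrite !mxE.
set ei : euclid R n := delta_mx i 0; set ej : euclid R n := delta_mx j 0.
pose P : 'M[R]_n := perm_mx (tperm i j).
have Pei : P *m ei = ej.
  rewrite /P -row_permE; apply/colP => k; rewrite !mxE !andbT.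
  by rewrite -(inj_eq (@perm_inj _ (tperm i j))) tpermK tpermL.
have Pa : P *m a = a.
  by rewrite /P -row_permE; apply/colP => k; rewrite mxE; case: tpermP => // ->.
have [dp dp0 apos] := pos_vec_near a0.
suff H e : 0 < e -> `|L ei - L ej| <= e.
  by apply/eqP; rewrite -subr_eq0 -normr_le0; apply/ler_addgt0Pr => e /H; rewrite add0r.
move=> e0.
pose b := 1 + `|ei| + `|ej|.
have b0 : 0 < b by rewrite /b -addrA ltr_pwDl ?addr_ge0.
have [df df0 fdf] := fL (e / b) (divr_gt0 e0 b0).
(* Small enough for [a + t e_i] to stay positive and for both increments to lie within [df]. *)
pose t := Num.min dp df / (2 * b).
have m0 : 0 < Num.min dp df by rewrite lt_min dp0.
have t0 : 0 < t by rewrite divr_gt0 ?mulr_gt0.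
have tb : t * b < Num.min dp df.
  have -> : t * b = Num.min dp df / 2 by rewrite /t; field; rewrite gt_eqF.
  lra.
clearbody t.
have small k : `|k| <= b -> `|t *: (k : euclid R n)| < Num.min dp df.
  by move=> kb; rewrite normrZ (gtr0_norm t0) (le_lt_trans _ tb)// ler_wpM2l// ltW.
have eib : `|ei| <= b by rewrite /b; have := normr_ge0 ej; lra.
have ejb : `|ej| <= b by rewrite /b; have := normr_ge0 ei; lra.
have := small _ eib; have := small _ ejb.
rewrite !lt_min => /andP[_ tj] /andP[tip ti].
have := fdf a (t *: ei); have := fdf a (t *: ej); rewrite subrr normr0.
move=> /(_ df0 tj) + /(_ df0 ti).
have -> : f (a + t *: ej) = f (a + t *: ei).
  have apos' : pos_vec (a + t *: ei) by apply: apos; rewrite addrC addKr.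
  rewrite -(f_sym (perm_mx_is_perm _ (tperm i j)) apos') -/P.
  by congr f; rewrite mulmxDr Pa -scalemxAr Pei.
have LZ x : L (t *: x) = t * L x by rewrite linearZ.
rewrite !LZ !normrZ (gtr0_norm t0) => Hj Hi.
have : `|t * (L ei - L ej)| <= e / b * (t * `|ej|) + e / b * (t * `|ei|).
  have -> : t * (L ei - L ej) = (f (a + t *: ei) - f a - t * L ej) -
      (f (a + t *: ei) - f a - t * L ei) by ring.
  apply: le_trans (ler_normB _ _) _; exact: lerD.
rewrite normrM (gtr0_norm t0).
have -> : e / b * (t * `|ej|) + e / b * (t * `|ei|) = t * (e * ((`|ei| + `|ej|) / b)).
  by field; rewrite gt_eqF.
rewrite ler_pM2l// => /le_trans; apply.
rewrite -[leRHS]mulr1 ler_pM2l// ler_pdivrMr// mul1r /b; lra.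
Qed.

(** A chain rule in which [d] need not be differentiable: its Lipschitz bound controls the error of
    [f], and only the sum weighted by the gradient has to be strictly differentiable. *)
Lemma strict_approx_comp_eigenvalues (A : sym_mx R (n + n)) N
    (L : {linear euclid R n -> R}) : posdef A -> diagonalizes A N ->
    strict_approx f L (d A) ->
  strict_approx (fun B => f (d B))
    (half_frob_form (N *m Dmx (gradient L) *m N^T)) A.
Proof.
move=> pA dN fL; have [a0 _ _] := symplectic_eigenvaluesP pA.
have [d1 [k [d10 k0 H1]]] := eigenvalue_sum_strict_compatible pA dN
  (gradient_compatible a0 fL).
have [d2 [l [d20 l0 H2]]] := symplectic_eigenvalues_lipschitz pA.
move=> e e0.
have l1 : 0 < l + 1 by lra.
have k1 : 0 < k + 1 by lra.
pose e1 := e / (2 * (l + 1)).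
have e10 : 0 < e1 by rewrite divr_gt0 ?mulr_gt0.
have [df df0 fdf] := fL e1 e10.
(* Halving keeps [C = B + u] within the radii [d1] and [d2]; [df / (l + 1)] brings [d B - d A] and
   [d C - d B] below [df]; the last bound makes [k (|B - A| + |C - A|)] at most [e]. *)
pose del := Num.min (Num.min (d1 / 2) (d2 / 2))
  (Num.min (df / (l + 1)) (e / (3 * (k + 1)))).
exists del; first by rewrite !lt_min !divr_gt0 ?mulr_gt0.
move=> B u /lt_min_and[/lt_min_and[B1 B2] /lt_min_and[B3 B4]].
move=> /lt_min_and[/lt_min_and[u1 u2] /lt_min_and[u3 u4]].
set C := B + u.
have uE : C - B = u by rewrite /C addrC addKr.
have CA : `|C - A| <= `|B - A| + `|u| by rewrite /C addrAC; exact: ler_normD.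
have Ad2 : `|A - A| < d2 by rewrite subrr normr0.
have Bd : `|d B - d A| < df.
  apply: le_lt_trans (H2 A B Ad2 (lt_of_half d20 B2)) _.
  exact: mulr_lt_of_div l0 (normr_ge0 _) B3.
have CBl : `|d C - d B| <= l * `|u|.
  rewrite -uE; exact: H2 (lt_of_half d20 B2) (lt_of_halves CA B2 u2).
have CBd : `|d C - d B| < df.
  exact: le_lt_trans CBl (mulr_lt_of_div l0 (normr_ge0 _) u3).
have I1 := fdf (d B) (d C - d B) Bd CBd.
rewrite (addrC (d B)) subrK gradientE in I1.
have sE : \sum_i gradient L i 0 * (d C - d B : 'cV[R]_n) i 0 =
    \sum_i gradient L i 0 * (d C i 0 - d B i 0).
  by apply: eq_bigr => i _; rewrite !mxE.
rewrite sE in I1.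
have I2 := H1 B C (lt_of_half d10 B1) (lt_of_halves CA B1 u1).
rewrite uE in I2.
apply: (@approx_combine _ _ _ _ _ (\sum_i gradient L i 0 * (d C i 0 - d B i 0))).
  exact: le_trans I1 (half_share e0 l0 (normr_ge0 _) CBl).
apply: le_trans I2 _; apply: ler_wpM2r; first exact: normr_ge0.
exact: third_share k0 e0 CA B4 u4.
Qed.

(** Near [d(A)], [f] is [f o d] composed with a bounded linear map [S], so the approximation pulls
    back. *)
Lemma strict_approx_of_comp (A : sym_mx R (n + n)) N
    (L : {linear sym_mx R (n + n) -> R}) : posdef A -> diagonalizes A N ->
    strict_approx (fun B => f (d B)) L A ->
  strict_approx f (L \o congr_Dmx (invmx N)) (d A).
Proof.
move=> pA [sN NAN] FL; have [a0 _ _] := symplectic_eigenvaluesP pA.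
have uN := symplectic_unitmx sN.
set S := congr_Dmx (invmx N).
have SA : S (d A) = A by apply: val_inj; exact: congr_invmx.
have [c c0 Sc] := congr_Dmx_bounded (invmx N).
have [d1 [b [d10 _ H1]]] := local_bound pA.
have [dp dp0 apos] := pos_vec_near a0.
have c1 : 0 < c + 1 by lra.
have fS (y : euclid R n) : `|y - d A| < dp -> `|y - d A| < d1 / (c + 1) ->
    f (d (S y)) = f y.
  move=> /apos y0 ya.
  have /H1[pS _] : `|S y - A| < d1.
    rewrite -SA -linearB; apply: le_lt_trans (Sc _) _.
    move: ya; rewrite ltr_pdivlMr// mulrC; apply: le_lt_trans.
    by rewrite ler_wpM2r// lerDl.
  (* [N] brings [S y] to [D_y] with [y] positive but possibly unsorted, so [d (S y)] is a
     permutation of [y], which [f] does not detect. *)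
  have [|s sE] := williamson_vec_perm (symplectic_eigenvaluesP pS) y0.
    exists N => //=; rewrite !mulmxA -trmx_mul mulVmx// trmx1 mul1mx.
    by rewrite -mulmxA mulVmx// mulmx1.
  have -> : d (S y) = perm_mx s *m y.
    by rewrite -row_permE; apply/colP => i; rewrite sE mxE.
  by apply: f_sym => //; exact: perm_mx_is_perm.
move=> e e0; have [dF dF0 HF] := FL (e / (c + 1)) (divr_gt0 e0 c1).
pose r := Num.min (Num.min dp (d1 / (c + 1))) (dF / (c + 1)).
have r0 : 0 < r by rewrite !lt_min dp0 !divr_gt0.
have Slt v : `|v| < dF / (c + 1) -> `|S v| < dF.
  rewrite ltr_pdivlMr// mulrC; apply: le_lt_trans; apply: le_trans (Sc _) _.
  by rewrite ler_wpM2r// lerDl.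
exists (r / 2) => [|y u ya ua]; first by rewrite divr_gt0.
have yr := lt_of_half r0 ya; have ur := lt_of_half r0 ua.
have yur : `|y + u - d A| < r.
  by rewrite addrAC; apply: lt_of_halves (ler_normD _ _) ya ua.
move: yr ur yur => /lt_min_and[/lt_min_and[y1 y2] y3] /lt_min_and[_ u3].
move=> /lt_min_and[/lt_min_and[v1 v2] _].
have SD : S (y + u) = S y + S u by exact: (linearD (congr_Dmx (invmx N))).
rewrite /= -(fS _ v1 v2) -(fS _ y1 y2) SD.
apply: le_trans (HF (S y) (S u) _ _) _; [by rewrite -SA -linearB Slt|exact: Slt|].
rewrite -mulrA ler_pM2l// ler_pdivrMl//; apply: le_trans (Sc _) _.
by rewrite ler_wpM2r// lerDl.
Qed.

End Transfer.

Theorem theorem3p16 (R : realType) (n : nat) (n_gt0 : (0 < n)%N)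
    (A : sym_mx R (n + n)) (A_posdef : posdef A)
    (f : euclid R n -> R) (f_sym : symmetric_fun f) :
  strictly_differentiable (fun B => f (symplectic_eigenvalues B)) A <->
  strictly_differentiable f (symplectic_eigenvalues A).
Proof.
have [N dN] := diagonalizes_exists A_posdef.
split=> [HF|Hf].
  have FL := strictly_differentiable_approx HF.
  apply: (@approx_strictly_differentiable _ _ _ _
    ('d (fun B => f (symplectic_eigenvalues B)) A \o congr_Dmx (invmx N))).
    have [k _ Sk] := congr_Dmx_bounded (invmx N).
    have dc := diff_continuous HF.1.
    move=> x; apply: continuous_comp; last exact: dc.
    exact: (bounded_linear_continuous Sk).
  exact: strict_approx_of_comp.
have fL := strictly_differentiable_approx Hf.
apply: (@approx_strictly_differentiable _ _ _ _ (half_frob_form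
    (N *m Dmx (gradient ('d f (symplectic_eigenvalues A))) *m N^T))).
  exact: half_frob_form_continuous.
exact: strict_approx_comp_eigenvalues.
Qed.
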